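(* Let $G$ be a simple graph of order $n>2$ with $m$ edges such that $G$ is not isomorphic to $K_{1,n-r-1}\cup rK_1$ for any $r$ with $0\le r\le \lceil n/2\rceil-2$ or $r=n-2$. Then $\mu_2(G)\ge\frac{2m}{n}$, with equality if and only if $G\cong nK_1$, or $n$ is even and $G\cong K_{n/2,n/2}$, or $n$ is even and $G\cong K_{1,n/2}\cup(n/2-1)K_1$.
   Context: The Laplacian matrix of $G$ is $L(G)=D(G)-A(G)$ ($D(G)$ diagonal degree matrix, $A(G)$ adjacency matrix), with eigenvalues $\mu_1(G)\ge\mu_2(G)\ge\cdots\ge\mu_n(G)=0$. $K_{1,p}$ is the star with $p$ leaves, $K_{r,s}$ the complete bipartite graph, $rK_1$ is $r$ isolated vertices, and $\cup$ denotes vertex-disjoint union. *)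

(* Defs.v *)
From HB Require Import structures.
From mathcomp Require Import all_boot all_order all_algebra.
From mathcomp Require Import spectral complex.

Set Implicit Arguments.
Unset Strict Implicit.
Unset Printing Implicit Defensive.

Import Order.TTheory GRing.Theory Num.Theory.
Local Open Scope ring_scope.

Record sgraph (V : finType) := SGraph {
  adj :> rel V;
  adj_sym : symmetric adj;
  adj_irr : irreflexive adj }.

Definition order_of (V : finType) (G : sgraph V) : nat := #|V|.

Definition edges (V : finType) (G : sgraph V) : {set {set V}} :=
  [set [set p.1; p.2] | p : V * V & G p.1 p.2].

Definition num_edges (V : finType) (G : sgraph V) : nat := #|edges G|.

Definition degree (V : finType) (G : sgraph V) (x : V) : nat :=
  #|[set y | G x y]|.

Definition gisom (V W : finType) (G : sgraph V) (H : sgraph W) : Prop :=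
  exists2 f : V -> W, bijective f & forall x y, H (f x) (f y) = G x y.

Section Constructions.

Lemma edgeless_sym (V : finType) : symmetric (fun _ _ : V => false).
Proof. by []. Qed.

Lemma edgeless_irr (V : finType) : irreflexive (fun _ _ : V => false).
Proof. by []. Qed.

Definition edgeless (r : nat) : sgraph 'I_r :=
  SGraph (@edgeless_sym 'I_r) (@edgeless_irr 'I_r).

Definition biclique_rel (r s : nat) : rel ('I_r + 'I_s)%type := fun u v =>
  match u, v with
  | inl _, inr _ | inr _, inl _ => true
  | _, _ => false
  end.

Lemma biclique_sym r s : symmetric (@biclique_rel r s).
Proof. by move=> [i|i] [j|j]. Qed.

Lemma biclique_irr r s : irreflexive (@biclique_rel r s).
Proof. by case. Qed.

Definition biclique (r s : nat) : sgraph ('I_r + 'I_s)%type :=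
  SGraph (@biclique_sym r s) (@biclique_irr r s).

Variables (V W : finType) (G : sgraph V) (H : sgraph W).

Definition gunion_rel : rel (V + W)%type := fun u v =>
  match u, v with
  | inl x, inl y => G x y
  | inr x, inr y => H x y
  | _, _ => false
  end.

Lemma gunion_sym : symmetric gunion_rel.
Proof. by move=> [x|x] [y|y] //=; apply: adj_sym. Qed.

Lemma gunion_irr : irreflexive gunion_rel.
Proof. by move=> [x|x] /=; apply: adj_irr. Qed.

Definition gunion : sgraph (V + W)%type := SGraph gunion_sym gunion_irr.

End Constructions.

(* The star with p leaves is 'K_(1, p); r*K1 is the graph of r isolated
   vertices. *)
Notation "''K_' ( r , s )" := (biclique r s) (format "''K_' ( r ,  s )").
Notation "r '*K1'" := (edgeless r) (at level 2, format "r *K1").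
Notation "G ':u:' H" := (gunion G H) (at level 50, left associativity).
Notation "G '~=g' H" := (gisom G H) (at level 70, no associativity).

Section RealSymmetricSpectrum.

Variable R : rcfType.

(* s lists the eigenvalues of A, with algebraic multiplicity, in nonincreasing
   order. *)
Definition is_spectrum n (A : 'M[R]_n) (s : n.-tuple R) : bool :=
  sorted >=%R s && (char_poly A == \prod_(a <- s) ('X - a%:P)).

Lemma symmx_spectrum_exists n (A : 'M[R]_n) :
  A^T = A -> exists s : n.-tuple R, is_spectrum A s.
Proof.
move=> Asym; pose f := real_complex R; pose B := map_mx f A.
have Breal : B \is a mxOver Num.real.
  by apply/mxOverP => i j; rewrite mxE; apply/complex_realP; exists (A i j).
have Bherm : B \is hermsymmx.
  apply: realsym_hermsym => //; apply/is_hermitianmxP.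
  by rewrite expr0 scale1r map_mx_id // /B map_trmx Asym.
have /orthomx_spectralP B_eq := hermitian_normalmx Bherm.
have /mxOverP dreal := hermitian_spectral_diag_real Bherm.
set P := spectralmx B in B_eq; set d := spectral_diag B in B_eq dreal.
have Punit : P \in unitmx := spectral_unit B.
have [c cP] : exists c : 'I_n -> R, forall i, d 0 i = f (c i).
  have cex i : exists k, d 0 i == f k.
    by have /complex_realP[k ->] := dreal 0 i; exists k.
  by exists (fun i => xchoose (cex i)) => i; apply/eqP/(xchooseP (cex i)).
have charB : char_poly B = \prod_(i < n) ('X - (d 0 i)%:P).
  pose Q := map_mx polyC (invmx P); pose S := map_mx polyC P.
  have QS : Q *m S = 1%:M by rewrite -map_mxM mulVmx // map_mx1.
  have charBE : char_poly_mx B = Q *m char_poly_mx (diag_mx d) *m S.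
    rewrite /char_poly_mx mulmxBr mulmxBl {1}B_eq !map_mxM; congr (_ - _).
    by rewrite scalar_mxC -mulmxA QS mulmx1.
  have -> : char_poly B = char_poly (diag_mx d).
    rewrite /char_poly charBE !det_mulmx mulrAC -det_mulmx QS det1.
    by rewrite mul1r.
  rewrite char_poly_trig ?diag_mx_is_trig //.
  by apply: eq_bigr => i _; rewrite mxE eqxx.
have charA : char_poly A = \prod_(i < n) ('X - (c i)%:P).
  apply: (map_poly_inj f); rewrite map_char_poly charB rmorph_prod /=.
  by apply: eq_bigr => i _; rewrite rmorphB /= map_polyX map_polyC cP.
have sz : size (sort >=%R [seq c i | i <- enum 'I_n]) == n.
  by rewrite size_sort size_map size_enum_ord.
exists (Tuple sz); apply/andP; split=> /=.
  by apply: sort_sorted => x y; apply: le_total.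
rewrite charA (perm_big [seq c i | i <- enum 'I_n]) ?perm_sort //=.
by rewrite big_map big_enum.
Qed.

End RealSymmetricSpectrum.

Section Laplacian.

Variables (R : rcfType) (V : finType) (G : sgraph V).

Definition adj_mx : 'M[R]_#|V| :=
  \matrix_(i, j) (G (enum_val i) (enum_val j))%:R.

Definition degree_mx : 'M[R]_#|V| :=
  diag_mx (\row_i (degree G (enum_val i))%:R).

Definition laplacian : 'M[R]_#|V| := degree_mx - adj_mx.

Lemma laplacian_sym : laplacian^T = laplacian.
Proof.
rewrite /laplacian linearB /= tr_diag_mx; congr (_ - _).
by apply/matrixP => i j; rewrite !mxE adj_sym.
Qed.

Definition laplacian_spectrum : #|V|.-tuple R :=
  xchoose (symmx_spectrum_exists laplacian_sym).

Lemma laplacian_spectrumP : is_spectrum laplacian laplacian_spectrum.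
Proof. exact: xchooseP. Qed.

(* Eigenvalues are numbered from 1: [lap_eig 1] is the largest one. *)
Definition lap_eig (k : nat) : R := nth 0 laplacian_spectrum k.-1.

End Laplacian.

Notation "''mu[' R ]_ k ( G )" := (@lap_eig R _ G k)
  (at level 8, k at level 2, format "''mu[' R ]_ k ( G )").

(* Main.v *)
Require Import Defs.
From HB Require Import structures.
From mathcomp Require Import all_boot all_order all_algebra.
From mathcomp Require Import all_fingroup spectral complex.
From mathcomp Require Import zify ring lra.

Set Implicit Arguments.
Unset Strict Implicit.
Unset Printing Implicit Defensive.

Import Order.TTheory GRing.Theory Num.Theory.
Local Open Scope ring_scope.

(* Write Q(x) for the Laplacian quadratic form, dbar for the average degree, v
   for a vertex of maximum degree and d for the largest degree of the other
   vertices.  By Courant-Fischer, mu_2 > t as soon as Q - t|.|^2 is positive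
   definite on some plane, and mu_2 <= t as soon as it is nonpositive on some
   hyperplane.  For the lower bound the plane is usually spanned by e_v and a
   vector x with x_v = 0 and with zero sum over N(v), so that e_v and x are
   orthogonal for both forms.

   If d >= 2, such planes give mu_2 >= d (Li and Pan), which settles dbar < d.
   If dbar >= d and deg v > d, the set F of neighbours of v of degree d has at
   least d elements.  An edge inside F gives the vector e_u - e_u'; if F is
   independent, one weights F and a vertex w adjacent to part of F (or to all
   of F), and counting the edges leaving F shows that a suitable w exists.
   If the graph is regular, triangles and pairs of distant edges force
   mu_2 > d, and a graph without them is K_{d,d}.  If d <= 1, the graph has two
   disjoint edges far apart or is a star with isolated vertices. *)

(** * Courant-Fischer bounds for the second largest eigenvalue, through the complex spectral
    theorem *)

Section CourantFischer.

Variable R : rcfType.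

Definition qform n (A : 'M[R]_n) (x : 'rV[R]_n) : R := (x *m A *m x^T) 0 0.

Local Notation C := R[i].
Local Notation toC := (map_mx (real_complex R)).

Definition hform n (A : 'M[C]_n) (z : 'rV[C]_n) : C :=
  (z *m A *m z ^t* )%sesqui 0 0.

(** Two factorisations of the characteristic polynomial show that [s] and the spectral diagonal
    agree up to a permutation; permuting the rows of the eigenvector matrix accordingly attaches
    coordinate [k] to the [k]-th entry of [s]. *)
Lemma hform_diag n (A : 'M[R]_n) (s : n.-tuple R) :
  A^T = A -> is_spectrum A s ->
  exists2 U : 'M[C]_n, U \is unitarymx &
    forall z, hform (toC A) z =
      \sum_(k < n) (real_complex R (tnth s k)) * `|(z *m U^t* )%sesqui 0 k| ^+
        2.
Proof.
move=> Asym /andP[_ /eqP charA]; pose f := real_complex R; pose B := toC A.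
have Breal : B \is a mxOver Num.real.
  by apply/mxOverP => i j; rewrite mxE; apply/complex_realP; exists (A i j).
have Bherm : B \is hermsymmx.
  apply: realsym_hermsym => //; apply/is_hermitianmxP.
  by rewrite expr0 scale1r map_mx_id // /B map_trmx Asym.
have /orthomx_spectralP B_eq := hermitian_normalmx Bherm.
set P := spectralmx B in B_eq; set d := spectral_diag B in B_eq.
have Pu : P \is unitarymx := spectral_unitarymx B.
have Punit : P \in unitmx := spectral_unit B.
have charB : char_poly B = \prod_(x <- [tuple d 0 i | i < n]) ('X - x%:P).
  pose Q := map_mx polyC (invmx P); pose S := map_mx polyC P.
  have QS : Q *m S = 1%:M by rewrite -map_mxM mulVmx // map_mx1.
  have charBE : char_poly_mx B = Q *m char_poly_mx (diag_mx d) *m S.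
    rewrite /char_poly_mx mulmxBr mulmxBl {1}B_eq !map_mxM; congr (_ - _).
    by rewrite scalar_mxC -mulmxA QS mulmx1.
  have -> : char_poly B = char_poly (diag_mx d).
    rewrite /char_poly charBE !det_mulmx mulrAC -det_mulmx QS det1.
    by rewrite mul1r.
  rewrite char_poly_trig ?diag_mx_is_trig // big_tuple.
  by apply: eq_bigr => i _; rewrite mxE eqxx tnth_mktuple.
have charB' : char_poly B = \prod_(x <- map f s) ('X - x%:P).
  rewrite -map_char_poly charA rmorph_prod /= big_map.
  by apply: eq_bigr => i _; rewrite rmorphB /= map_polyX map_polyC.
have /tuple_permP[p sp] : perm_eq (map f s) [tuple d 0 i | i < n].
  by apply: prod_XsubC_eq; rewrite -charB' -charB.
have dp k : d 0 (p k) = f (tnth s k).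
  have := congr1 (fun t => nth 0 t k) sp.
  rewrite (nth_map 0) ?size_tuple // -tnth_nth => ->.
  by rewrite -tnth_nth !tnth_mktuple.
exists (row_perm p P) => [|z].
  apply/unitarymxP/matrixP => i j.
  have /unitarymxP/matrixP/(_ (p i) (p j)) := Pu.
  rewrite !mxE (inj_eq perm_inj) => <-.
  by apply: eq_bigr => k _; rewrite !mxE.
rewrite /hform -/B B_eq (invmx_unitary Pu) -!mulmxA mulmxA mulmxA.
rewrite -[P *m _]trmxK.
have -> : (P *m z^t*)%sesqui = ((z *m P^t*)^t*)%sesqui.
  by rewrite trmx_mul map_mxM trmxCK.
rewrite mxE (reindex_inj (@perm_inj _ p)) /=; apply: eq_bigr => k _.
rewrite mul_mx_diag !mxE dp normCK.
have <- : \sum_j z 0 j * (P ^t*)%sesqui j (p k) =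
          \sum_j z 0 j * (row_perm p P ^t*)%sesqui j k.
  by apply: eq_bigr => j _; rewrite !mxE.
by rewrite [RHS]mulrA; congr (_ * _); rewrite mulrC.
Qed.

Lemma hform1 n (U : 'M[C]_n) (z : 'rV[C]_n) : U \is unitarymx ->
  hform 1%:M z = \sum_(k < n) `|(z *m U^t* )%sesqui 0 k| ^+ 2.
Proof.
move=> Uu; rewrite /hform mulmx1.
have -> : (z *m z^t* = z *m U^t* *m (z *m U^t* )^t*)%sesqui.
  by rewrite trmx_mul map_mxM trmxCK mulmxA mulmxKtV.
by rewrite mxE; apply: eq_bigr => k _; rewrite !mxE normCK.
Qed.

(* The form is real on complex vectors, so an inequality for a complex vector
   passes to its real or to its imaginary part; this is how real test vectors
   are extracted from the complex spectral theorem. *)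
Lemma hform_ReIm n (A : 'M[R]_n) (x y : 'rV[R]_n) : A^T = A ->
  hform (toC A) (toC x + 'i%C *: toC y) =
  real_complex R (qform A x + qform A y).
Proof.
move=> Asym; rewrite /hform /qform.
have -> : ((toC x + 'i%C *: toC y)^t* = (toC x^T - 'i%C *: toC y^T))%sesqui.
  apply/matrixP => i j; rewrite !mxE rmorphD rmorphM /=.
  by apply/eqP; rewrite eq_complex /=; apply/andP; split; apply/eqP; ring.
rewrite mulmxDl mulmxBr !mulmxDl -!scalemxAl -!scalemxAr -!map_mxM.
have yx : y *m A *m x^T = (x *m A *m y^T)^T.
  by rewrite !trmx_mul trmxK Asym mulmxA.
rewrite yx; rewrite !mxE.
set a := \sum_j _; set b := \sum_j _; set c := \sum_j _.
by apply/eqP; rewrite eq_complex /=; apply/andP; split; apply/eqP; ring.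
Qed.

Lemma toC_row_rect n (z : 'rV[C]_n) :
  exists x y : 'rV[R]_n, z = toC x + 'i%C *: toC y.
Proof.
exists (map_mx (@complex.Re R) z), (map_mx (@complex.Im R) z).
apply/rowP => k; do 6!rewrite mxE; rewrite {1}[z 0 k]complexE; reflexivity.
Qed.

Lemma isotropic_pair (F : fieldType) (u v : F) :
  exists a b : F, (a, b) != (0, 0) /\ a * u + b * v = 0.
Proof.
case: (eqVneq v 0) => [->|v0].
  by exists 0, 1; rewrite mul0r mul1r add0r xpair_eqE oner_eq0 andbF.
by exists v, (- u); rewrite mulNr mulrC subrr xpair_eqE (negPf v0).
Qed.

Lemma qform0 n (A : 'M[R]_n) : qform A 0 = 0.
Proof. by rewrite /qform !mul0mx mxE. Qed.

Lemma spectrum_le n (A : 'M[R]_n) (s : n.-tuple R) (i j : nat) :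
  is_spectrum A s -> (i <= j < n)%N -> nth 0 s j <= nth 0 s i.
Proof.
move=> /andP[ss _] /andP[ij jn].
apply: (sorted_leq_nth (leT := >=%R)) => //.
- by move=> a b c; exact: ge_trans.
- exact: ge_refl.
- by rewrite inE size_tuple (leq_ltn_trans ij).
- by rewrite inE size_tuple.
Qed.

Lemma toC_scaleE n (a : C) (x : 'rV[R]_n) i k :
  (a *: toC x) i k = a * real_complex R (x i k).
Proof. by rewrite [LHS]mxE [toC x i k]mxE. Qed.

(** Over the complex numbers, some nontrivial combination of [y1] and [y2] is orthogonal to the
    leading eigenvector, and there the form is at most the second entry of [s] times the squared
    norm. Nontriviality concerns the coefficients, as [y1] and [y2] may be dependent. *)
Lemma second_eig_le n (A : 'M[R]_n) (s : n.-tuple R) (y1 y2 : 'rV[R]_n) :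
  A^T = A -> is_spectrum A s -> (1 < n)%N ->
  exists a b : R, let z := a *: y1 + b *: y2 in
    (a, b) != (0, 0) /\ qform A z <= nth 0 s 1 * qform 1%:M z.
Proof.
move=> Asym sA n1; have [U Uu Uform] := hform_diag Asym sA.
pose k0 := Ordinal (ltnW n1).
have [al [be [abN0 ab0]]] := isotropic_pair ((toC y1 *m U^t* )%sesqui 0 k0)
   ((toC y2 *m U^t* )%sesqui 0 k0).
case: al be abN0 ab0 => [a1 a2] [b1 b2] abN0 ab0.
set x := a1 *: y1 + b1 *: y2; set y := a2 *: y1 + b2 *: y2.
have zE : Complex a1 a2 *: toC y1 + Complex b1 b2 *: toC y2 =
    toC x + 'i%C *: toC y.
  apply/matrixP => i k.
  rewrite [LHS]mxE [RHS]mxE !toC_scaleE.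
  rewrite [toC x i k]mxE.
  have -> : x i k = a1 * y1 i k + b1 * y2 i k by rewrite !mxE.
  have -> : y i k = a2 * y1 i k + b2 * y2 i k by rewrite !mxE.
  by apply/eqP; rewrite eq_complex /=; apply/andP; split; apply/eqP; ring.
have zk0 : ((Complex a1 a2 *: toC y1 + Complex b1 b2 *: toC y2) *m U^t* )%sesqui
    0 k0 = 0.
  by rewrite mulmxDl -!scalemxAl -[RHS]ab0 mxE; congr (_ + _); rewrite mxE.
have : hform (toC A) (toC x + 'i%C *: toC y) <=
    real_complex R (nth 0 s 1) * hform 1%:M (toC x + 'i%C *: toC y).
  rewrite (hform1 _ Uu) Uform mulr_sumr; apply: ler_sum => k _.
  have [->|kN0] := eqVneq k k0.
    by rewrite -zE zk0 normr0 expr0n !mulr0.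
  apply: ler_wpM2r; first exact: exprn_ge0.
    rewrite lecR (tnth_nth 0).
  by apply: (spectrum_le sA); rewrite ltn_ord andbT lt0n.
have sym1 : (1%:M : 'M[R]_n)^T = 1%:M by rewrite trmx1.
have <- : toC 1%:M = 1%:M :> 'M[C]_n by rewrite map_mx1.
rewrite !(hform_ReIm _ _ Asym, hform_ReIm _ _ sym1) -rmorphM lecR mulrDr.
move=> {zk0 Uform Uu ab0 zE} le_xy.
(* The inequality holds for [x] and [y] added together, hence for one of them; the case split picks
   one with nonzero coefficients. *)
case: (eqVneq (a1, b1) (0, 0)) => [[a10 b10]|ab1].
  exists a2, b2; split.
    by apply: contraNneq abN0 => -[-> ->]; rewrite a10 b10.
  move: le_xy; rewrite /x a10 b10 !scale0r addr0 !qform0 mulr0 !add0r; exact.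
case: (lerP (qform A x) (nth 0 s 1 * qform 1%:M x)) => [lex|ltx].
  by exists a1, b1.
exists a2, b2; split; last by move: le_xy ltx; rewrite -/y; lra.
apply/eqP => -[a20 b20]; move: le_xy; rewrite /y a20 b20 !scale0r addr0.
by rewrite !qform0 mulr0 !addr0 leNgt ltx.
Qed.

(** Dually, some nonzero combination of the first two eigenvectors is annihilated by [c], and on
    their span the form is at least the second entry of [s] times the squared norm. *)
Lemma second_eig_ge n (A : 'M[R]_n) (s : n.-tuple R) (c : 'cV[R]_n) :
  A^T = A -> is_spectrum A s -> (1 < n)%N ->
  exists z : 'rV[R]_n,
    [/\ z != 0, z *m c = 0 & nth 0 s 1 * qform 1%:M z <= qform A z].
Proof.
move=> Asym sA n1; have [U Uu Uform] := hform_diag Asym sA.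
pose k0 := Ordinal (ltnW n1); pose k1 := Ordinal n1.
have [al [be [abN0 ab0]]] :=
  isotropic_pair ((U *m toC c) k0 0) ((U *m toC c) k1 0).
pose w : 'rV[C]_n := al *: delta_mx 0 k0 + be *: delta_mx 0 k1.
have wUc : w *m U *m toC c = 0.
  rewrite -mulmxA mulmxDl -!scalemxAl -!rowE.
  apply/matrixP => i k; rewrite (ord1 k) [RHS]mxE -[RHS]ab0 [LHS]mxE.
  by congr (_ + _); rewrite [LHS]mxE; congr (_ * _); rewrite mxE.
have wUU : (w *m U *m U^t* = w)%sesqui by rewrite mulmxtVK.
have wk k : w 0 k = (k == k0)%:R * al + (k == k1)%:R * be.
  by rewrite !mxE !eqxx /= [al * _]mulrC [be * _]mulrC.
have [x [y zE]] := toC_row_rect (w *m U).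
have xyN0 : (x, y) != (0, 0).
  apply: contraNneq abN0 => -[x0 y0].
  have w0 : w = 0 by rewrite -wUU zE x0 y0 map_mx0 scaler0 addr0 mul0mx.
  move: (wk k0) (wk k1);
    rewrite w0 !mxE !eqxx /= !mul0r mul1r mul1r addr0 add0r.
  by move=> <- <-.
have [xc yc] : x *m c = 0 /\ y *m c = 0.
  move: wUc; rewrite zE mulmxDl -scalemxAl -!map_mxM => /matrixP E.
  by split; apply/matrixP => i j; have := E i j; rewrite !mxE;
     move=> /eqP; rewrite eq_complex /= => /andP[/eqP + /eqP +];
     lra.
have : real_complex R (nth 0 s 1) * hform 1%:M (toC x + 'i%C *: toC y) <=
    hform (toC A) (toC x + 'i%C *: toC y).
  rewrite (hform1 _ Uu) Uform mulr_sumr -zE wUU; apply: ler_sum => k _.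
  have [k2|k2] := leqP k 1.
    apply: ler_wpM2r; first exact: exprn_ge0.
    rewrite lecR (tnth_nth 0).
    by apply: (spectrum_le sA); rewrite k2.
  rewrite wk -!val_eqE /= !gtn_eqF ?(ltnW k2) // !mul0r addr0 normr0.
  by rewrite expr0n !mulr0.
have sym1 : (1%:M : 'M[R]_n)^T = 1%:M by rewrite trmx1.
have <- : toC 1%:M = 1%:M :> 'M[C]_n by rewrite map_mx1.
rewrite !(hform_ReIm _ _ Asym, hform_ReIm _ _ sym1) -rmorphM lecR mulrDr.
move=> {wUc wUU wk Uform Uu ab0 zE} le_xy.
case: (eqVneq x 0) => [x0|xN0].
  exists y; split => //; first by apply: contraNneq xyN0 => ->; rewrite x0.
  by move: le_xy; rewrite x0 !qform0 mulr0 !add0r.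
case: (lerP (nth 0 s 1 * qform 1%:M x) (qform A x)) => [lex|ltx].
  by exists x.
exists y; split => //; last by move: le_xy ltx; lra.
apply/eqP => y0; move: le_xy; rewrite y0.
by rewrite !qform0 mulr0 !addr0 leNgt ltx.
Qed.

End CourantFischer.

(** * The Laplacian form on functions of the vertices *)

Section GraphForm.

Variables (R : rcfType) (V : finType) (G : sgraph V).
Implicit Types (x y z : V -> R) (u v w : V) (t : R).

Definition lap x u : R := \sum_(w | G u w) (x u - x w).

(** The bilinear form of [L - t I], with [L] the Laplacian: its sign compares Rayleigh quotients
    with [t]. *)
Definition bform t x y : R := \sum_u x u * (lap y u - t * y u).

Definition delta u : V -> R := fun w => (w == u)%:R.

Lemma lapE x u : lap x u = (degree G u)%:R * x u - \sum_(w | G u w) x w.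
Proof.
rewrite /lap sumrB; congr (_ - _);
  by rewrite sumr_const mulr_natl /degree cardsE.
Qed.

Lemma lap_comb a b x y u :
  lap (fun w => a * x w + b * y w) u = a * lap x u + b * lap y u.
Proof.
rewrite /lap !mulr_sumr -big_split /=; apply: eq_bigr => w _; ring.
Qed.

Lemma lap_deltaE u w :
  lap (delta u) w = (degree G w)%:R * (w == u)%:R - (G w u)%:R.
Proof.
rewrite lapE /delta; congr (_ - _).
case: (boolP (G w u)) => [wu|wu].
  by rewrite (bigD1 u) //= eqxx big1 ?addr0 // => z /andP[_ /negPf->].
by rewrite big1 // => z wz; case: eqVneq wz wu => // -> ->.
Qed.

Lemma sum_delta u (F : V -> R) : \sum_w delta u w * F w = F u.
Proof.
rewrite (bigD1 u) //= /delta eqxx mul1r big1 ?addr0 // => w /negPf->.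
by rewrite mul0r.
Qed.

Lemma bform_delta t u y : bform t (delta u) y = lap y u - t * y u.
Proof. exact: sum_delta. Qed.

Lemma bform_combl t a b x y z :
  bform t (fun w => a * x w + b * y w) z = a * bform t x z + b * bform t y z.
Proof.
by rewrite /bform !mulr_sumr -big_split /=; apply: eq_bigr => w _; ring.
Qed.

Lemma bform_combr t a b x y z :
  bform t z (fun w => a * x w + b * y w) = a * bform t z x + b * bform t z y.
Proof.
rewrite /bform !mulr_sumr -big_split /=; apply: eq_bigr => w _.
by rewrite lap_comb; ring.
Qed.

Lemma bform_sym t x y : bform t x y = bform t y x.
Proof.
rewrite /bform.
have E (a b : V -> R) : \sum_u a u * (lap b u - t * b u) =
   \sum_u ((degree G u)%:R - t) * (a u * b u) -
   \sum_u \sum_w (G u w)%:R * (a u * b w).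
  rewrite -sumrB; apply: eq_bigr => u _; rewrite lapE.
  have -> : \sum_w (G u w)%:R * (a u * b w) = a u * \sum_(w | G u w) b w.
    by rewrite mulr_sumr [RHS]big_mkcond /=; apply: eq_bigr => w _;
       case: (G u w); rewrite ?mul1r ?mul0r.
  ring.
rewrite !E; congr (_ - _); first by apply: eq_bigr => u _; congr (_ * _);
  exact: mulrC.
rewrite exchange_big /=; apply: eq_bigr => u _; apply: eq_bigr => w _.
by rewrite adj_sym [x _ * _]mulrC.
Qed.

Lemma bform_shift t t' x :
  bform t x x = bform t' x x + (t' - t) * \sum_u x u ^+ 2.
Proof.
rewrite /bform mulr_sumr -big_split /=; apply: eq_bigr => u _; ring.
Qed.

Lemma bform_shift2 t t' x y :
  bform t x y = bform t' x y + (t' - t) * \sum_u x u * y u.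
Proof.
rewrite /bform mulr_sumr -big_split /=; apply: eq_bigr => u _; ring.
Qed.

Lemma bform_comb_diag t a b x y :
  let z := fun w => a * x w + b * y w in
  bform t z z =
  a ^+ 2 * bform t x x + 2 * a * b * bform t x y + b ^+ 2 * bform t y y.
Proof.
by rewrite /= bform_combl !bform_combr (bform_sym t y x); ring.
Qed.

Definition vec x : 'rV[R]_#|V| := \row_i x (enum_val i).

Lemma sum_enum_val (F : V -> R) : \sum_(i < #|V|) F (enum_val i) = \sum_u F u.
Proof.
by rewrite [RHS](reindex (enum_val (A := V))) //; exact/onW_bij/enum_val_bij.
Qed.

Lemma vec_lap x j : (vec x *m laplacian R G) 0 j = lap x (enum_val j).
Proof.
rewrite mxE lapE /laplacian.
transitivity (\sum_(i < #|V|) (delta (enum_val j) (enum_val i) *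
    ((degree G (enum_val i))%:R * x (enum_val i)) -
    (G (enum_val j) (enum_val i))%:R * x (enum_val i))).
  apply: eq_bigr => i _; rewrite !mxE /delta (inj_eq enum_val_inj) adj_sym.
  by case: (i == j); rewrite ?mulr1n ?mulr0n; ring.
rewrite sumrB (sum_enum_val (fun u => delta _ u * ((degree G u)%:R * x u))).
rewrite (sum_enum_val (fun u => (G (enum_val j) u)%:R * x u)) sum_delta.
congr (_ - _); rewrite [RHS]big_mkcond /=; apply: eq_bigr => w _.
by case: (G _ w); rewrite ?mul1r ?mul0r.
Qed.

Lemma qform_vec x : qform (laplacian R G) (vec x) = \sum_u x u * lap x u.
Proof.
rewrite /qform mxE -sum_enum_val; apply: eq_bigr => i _.
by rewrite vec_lap !mxE mulrC.
Qed.

Lemma qform1_vec x : qform 1%:M (vec x) = \sum_u x u * x u.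
Proof.
rewrite /qform mulmx1 mxE -sum_enum_val; apply: eq_bigr => i _.
by rewrite !mxE.
Qed.

Hypothesis V_gt1 : (1 < #|V|)%N.
Local Notation mu2 := ('mu[R]_2(G)).

Lemma bform_vec t x :
  bform t x x = qform (laplacian R G) (vec x) - t * qform 1%:M (vec x).
Proof.
rewrite qform_vec qform1_vec mulr_sumr -sumrB; apply: eq_bigr => u _; ring.
Qed.

Lemma mu2_comb y1 y2 : exists a b : R, (a, b) != (0, 0) /\
  bform mu2 (fun w => a * y1 w + b * y2 w) (fun w => a * y1 w + b * y2 w) <= 0.
Proof.
have [a [b [abN0 ab]]] := second_eig_le (vec y1) (vec y2)
  (laplacian_sym R G) (laplacian_spectrumP R G) V_gt1.
exists a, b; split => //; rewrite bform_vec subr_le0.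
have -> : vec (fun w => a * y1 w + b * y2 w) = a *: vec y1 + b *: vec y2.
  by apply/rowP => i; rewrite !mxE.
exact: ab.
Qed.

(** The hypotheses make the Gram matrix of [y1], [y2] positive definite. If [mu2 <= t], the form at
    [t] is at most the form at [mu2], which is nonpositive at some nontrivial combination. *)
Lemma mu2_gt t y1 y2 : 0 < bform t y1 y1 -> 0 < bform t y2 y2 ->
  bform t y1 y2 ^+ 2 < bform t y1 y1 * bform t y2 y2 -> t < mu2.
Proof.
move=> b1 b2 b12; rewrite ltNge; apply/negP => mu_t.
have [a [b [abN0 ab]]] := mu2_comb y1 y2.
have : bform t (fun w => a * y1 w + b * y2 w) (fun w => a * y1 w + b * y2 w) <=
  0.
  rewrite (bform_shift t mu2) (le_trans _ ab) // gerDl mulr_le0_ge0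
    ?subr_le0 //.
  by rewrite sumr_ge0 // => u _; rewrite sqr_ge0.
rewrite bform_comb_diag; set p := bform t y1 y1 in b1 b12 *.
set q := bform t y2 y2 in b2 b12 *; set r := bform t y1 y2 in b12 *.
rewrite leNgt => /negP; apply; rewrite -(pmulr_rgt0 _ b1).
(* Completing the square, after multiplication by [p > 0]. *)
have -> : p * (a ^+ 2 * p + 2 * a * b * r + b ^+ 2 * q) =
  (p * a + r * b) ^+ 2 + b ^+ 2 * (p * q - r ^+ 2) by ring.
have pos : 0 < p * q - r ^+ 2 by rewrite subr_gt0.
case: (eqVneq b 0) => [b0|bN0].
  have aN0 : a != 0 by apply: contraNneq abN0 => ->; rewrite b0.
  rewrite b0 mulr0 addr0 expr0n mul0r addr0 exprn_even_gt0 //=.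
  by rewrite mulf_neq0 // gt_eqF.
by rewrite ltr_wpDl ?sqr_ge0 // mulr_gt0 // exprn_even_gt0.
Qed.

(** If [mu2 < t], lowering [t] to [mu2] adds a positive multiple of the squared norm, so the plane
    becomes positive definite and [mu2_gt] yields [mu2 < mu2]. *)
Lemma mu2_ge t y1 y2 : 0 <= bform t y1 y1 -> 0 <= bform t y2 y2 ->
  bform t y1 y2 = 0 -> \sum_u y1 u * y2 u = 0 ->
  0 < \sum_u y1 u ^+ 2 -> 0 < \sum_u y2 u ^+ 2 -> t <= mu2.
Proof.
move=> b1 b2 b12 y12 n1 n2; rewrite leNgt; apply/negP => mu_t.
suff : mu2 < mu2 by rewrite ltxx.
have mt : 0 < t - mu2 by rewrite subr_gt0.
have p1 := mulr_gt0 mt n1; have p2 := mulr_gt0 mt n2.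
apply: (@mu2_gt _ y1 y2).
- by rewrite (bform_shift _ t) ltr_wpDl.
- by rewrite (bform_shift _ t) ltr_wpDl.
rewrite (bform_shift2 _ t) b12 y12 mulr0 addr0 expr0n /=.
by rewrite !(bform_shift mu2 t) mulr_gt0 // ltr_wpDl.
Qed.

(** The hyperplane orthogonal to [c] contains a nonzero vector with Rayleigh quotient at least
    [mu2], by [second_eig_ge]. *)
Lemma mu2_upper t (c : V -> R) :
  (forall z, \sum_u z u * c u = 0 -> bform t z z <= 0) -> mu2 <= t.
Proof.
move=> le0.
have [z [zN0 zc zform]] := second_eig_ge (vec c)^T
  (laplacian_sym R G) (laplacian_spectrumP R G) V_gt1.
pose x u := z 0 (enum_rank u).
have zE : z = vec x by apply/rowP => i; rewrite mxE /x enum_valK.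
have xc : \sum_u x u * c u = 0.
  transitivity ((z *m (vec c)^T) 0 0); last by rewrite zc mxE.
  rewrite mxE -[LHS](sum_enum_val (fun u => x u * c u)) zE.
  by apply: eq_bigr => i _; rewrite !mxE.
have := le0 x xc; rewrite bform_vec -zE subr_le0 => le1.
have pos : 0 < qform 1%:M z.
  rewrite zE qform1_vec lt0r sumr_ge0 ?andbT; last first.
    by move=> u _; rewrite -expr2 sqr_ge0.
  apply: contraNneq zN0 => x0; rewrite zE; apply/eqP/rowP => i; rewrite !mxE.
  have ge0 u : true -> 0 <= x u * x u by rewrite -expr2 sqr_ge0.
  have /eqP := psumr_eq0P ge0 x0 (i := enum_val i) isT.
  by rewrite mulf_eq0 orbb => /eqP.
by rewrite -(ler_pM2r pos) (le_trans zform).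
Qed.

End GraphForm.

(** * Test vectors and the bound by the second largest degree *)

Section TestVectors.

Variables (R : rcfType) (V : finType) (G : sgraph V).
Hypothesis V_gt1 : (1 < #|V|)%N.
Implicit Types (x y z : V -> R) (u v w : V) (t : R).
Local Notation mu2 := ('mu[R]_2(G)).
Local Notation deg := (degree G).
Local Notation delta := (@delta R V).
Local Notation lap := (lap G).
Local Notation bform := (bform G).

(* The two conditions at v make delta v and x orthogonal for the inner product
   and for the Laplacian form. *)
Lemma mu2_gt_star t v x : x v = 0 -> lap x v = 0 ->
  t < (deg v)%:R -> 0 < bform t x x -> t < mu2.
Proof.
move=> xv lv tv bx.
have bv : bform t (delta v) (delta v) = (deg v)%:R - t.
  by rewrite bform_delta lap_deltaE /delta eqxx adj_irr; rewrite /=; ring.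
apply: (mu2_gt V_gt1 (y1 := delta v) (y2 := x)) => //.
  by rewrite bv subr_gt0.
by rewrite bform_delta xv lv mulr0 subr0 expr0n mulr_gt0 // bv subr_gt0.
Qed.

Lemma mu2_ge_star t v x : x v = 0 -> lap x v = 0 ->
  t <= (deg v)%:R -> 0 <= bform t x x -> 0 < \sum_u x u ^+ 2 -> t <= mu2.
Proof.
move=> xv lv tv bx nx.
have bv : bform t (delta v) (delta v) = (deg v)%:R - t.
  by rewrite bform_delta lap_deltaE /delta eqxx adj_irr; rewrite /=; ring.
apply: (mu2_ge V_gt1 (y1 := delta v) (y2 := x)) => //.
- by rewrite bv subr_ge0.
- by rewrite bform_delta xv lv; rewrite /=; ring.
- by rewrite sum_delta.
by rewrite (eq_bigr _ (fun u _ => expr2 _)) sum_delta /delta eqxx.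
Qed.

(** The explicit coefficients let the combination lemmas for [lap] and [bform] apply. When [u] and
    [w] are both adjacent to [v], this vector meets the conditions of [mu2_gt_star] at [v]. *)
Definition pair u w : V -> R := fun a => 1 * delta u a + (-1) * delta w a.

Lemma bform_pair t a b c e : bform t (pair a b) (pair c e) =
  bform t (delta a) (delta c) - bform t (delta a) (delta e) -
  bform t (delta b) (delta c) + bform t (delta b) (delta e).
Proof. by rewrite bform_combl !bform_combr; rewrite /=; ring. Qed.

Lemma bform_deltas t a b : bform t (delta a) (delta b) =
  ((deg a)%:R - t) * (a == b)%:R - (G a b)%:R.
Proof. by rewrite bform_delta lap_deltaE /delta; rewrite /=; ring. Qed.

Lemma bform_pair_diag t a b : a != b ->
  bform t (pair a b) (pair a b) =
  (deg a)%:R + (deg b)%:R + 2 * (G a b)%:R - 2 * t.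
Proof.
move=> /negPf ab; rewrite bform_pair !bform_deltas !eqxx [b == a]eq_sym ab.
by rewrite !adj_irr [G b a]adj_sym /=; ring.
Qed.

Lemma pair_norm a b : a != b -> \sum_u pair a b u ^+ 2 = 2.
Proof.
move=> ab; rewrite (bigD1 a) //= (bigD1 b) 1?eq_sym //= big1 =>
  [|u /andP[ua ub]].
  by rewrite /pair /delta !eqxx [b == a]eq_sym (negPf ab); rewrite /=; ring.
by rewrite /pair /delta (negPf ua) (negPf ub); rewrite /=; ring.
Qed.

Lemma lap_pair a b u : lap (pair a b) u =
  (deg u)%:R * pair a b u - (G u a)%:R + (G u b)%:R.
Proof. by rewrite lap_comb !lap_deltaE /pair /delta; rewrite /=; ring. Qed.

Lemma adj_neq u w : G u w -> u != w.
Proof. by apply: contraTneq => ->; rewrite adj_irr. Qed.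

(** [bform 0 x x] is the sum of squared differences over all edges; only the edges meeting [u] or
    [v] are kept, and [w != v] avoids counting an edge [uv] twice. *)
Lemma edge_form_lb x u v : u != v ->
  \sum_(w | G v w) (x v - x w) ^+ 2 +
  \sum_(w | G u w && (w != v)) (x u - x w) ^+ 2 <= bform 0 x x.
Proof.
move=> uv; pose g a b := (G a b)%:R * (x a - x b) ^+ 2.
have g0 a b : 0 <= g a b by rewrite mulr_ge0 ?sqr_ge0.
have gC a b : g a b = g b a by rewrite /g adj_sym -(opprB (x b)) sqrrN.
have gE a (P : pred V) :
  \sum_(b | G a b && P b) (x a - x b) ^+ 2 = \sum_(b | P b) g a b.
  rewrite [LHS]big_mkcondl /=; apply: eq_bigr => b _; rewrite /g.
  by case: (G a b); rewrite ?mul1r ?mul0r.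
have E : 2 * bform 0 x x = \sum_a \sum_b g a b.
  have -> : bform 0 x x = \sum_a \sum_b (G a b)%:R * (x a * (x a - x b)).
    apply: eq_bigr => a _; rewrite mul0r subr0 /lap mulr_sumr big_mkcond /=.
    by apply: eq_bigr => b _; case: (G a b); rewrite ?mul1r ?mul0r.
  rewrite mulr2n mulrDl mul1r {2}exchange_big /= -big_split /=.
  apply: eq_bigr => a _; rewrite -big_split /=; apply: eq_bigr => b _.
  by rewrite /g [G b a]adj_sym; rewrite /=; ring.
have -> : \sum_(w | G v w) (x v - x w) ^+ 2 = \sum_w g v w.
  by rewrite -(gE v xpredT); apply: eq_bigl => w; rewrite andbT.
rewrite gE -(ler_pM2l (ltr0n R 2)) E.
have E3 : \sum_a \sum_b g a b = \sum_b g v b + (\sum_b g u b +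
    \sum_(a | (a != v) && (a != u)) \sum_b g a b).
  by rewrite [LHS](bigD1 v) //=; congr (_ + _); rewrite [LHS](bigD1 u).
(* The remaining rows contribute at least their entries in the columns [v] and [u], which by
   symmetry repeat the rows of [v] and [u]. *)
have le1 : \sum_(a | (a != v) && (a != u)) (g a v + g a u) <=
    \sum_(a | (a != v) && (a != u)) \sum_b g a b.
  apply: ler_sum => a _; rewrite (bigD1 v) //= (bigD1 u) //= addrA lerDl.
  by rewrite sumr_ge0.
have gvv a : g a a = 0 by rewrite /g adj_irr mul0r.
have Sv : \sum_b g v b = g u v + \sum_(a | (a != v) && (a != u)) g a v.
  rewrite (bigD1 v) //= gvv add0r (bigD1 u) //= gC; congr (_ + _).
  by apply: eq_bigr => a _; rewrite gC.
have Su : \sum_(b | b != v) g u b = \sum_(a | (a != v) && (a != u)) g a u.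
  by rewrite (bigD1 u) //= gvv add0r; apply: eq_bigr => a _; rewrite gC.
have Su2 : \sum_b g u b = g u v + \sum_(b | b != v) g u b by rewrite (bigD1 v).
move: le1; rewrite big_split /= -Su E3 Su2 Sv.
have := g0 u v.
lra.
Qed.

Lemma sum_ind (P : pred V) (c : R) : \sum_w (P w)%:R * c = #|P|%:R * c.
Proof.
rewrite -sum1_card natr_sum mulr_suml [RHS]big_mkcond /=.
by apply: eq_bigr => w _; rewrite unfold_in; case: (P w); rewrite ?mul0r.
Qed.

(* Here a = 1 / (deg v - 1) and b = 1 / (deg u - 1) are the weights of the test
   vector of [mu2_ge_second], c and k the numbers of neighbours of u (other than
   v) inside and outside N(v), and l a lower bound for the Laplacian form. *)
Lemma second_arith (a b c k l : R) : 0 <= a -> a <= b -> 0 <= c -> 0 <= k ->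
  (c + k) * b = 1 -> 1 + a + (c * (1 + a) ^+ 2 + k * (1 + b) ^+ 2) <= l ->
  0 <= l + (0 - (1 + (c + k))) * (1 + (a + k * b ^+ 2)).
Proof.
move=> a0 ab c0 k0 cb le_l.
have E : 1 + a + (c * (1 + a) ^+ 2 + k * (1 + b) ^+ 2) -
    (1 + (c + k)) * (1 + (a + k * b ^+ 2)) =
    c * a + c * a ^+ 2 + k * (b - a) + k * b * (1 - (c + k) * b) by ring.
have p1 : 0 <= c * a by rewrite mulr_ge0.
have p2 : 0 <= c * a ^+ 2 by rewrite mulr_ge0 ?sqr_ge0.
have p3 : 0 <= k * (b - a) by rewrite mulr_ge0 ?subr_ge0.
move: E; rewrite cb subrr mulr0; lra.
Qed.

(** If [u] and [v] are not adjacent, their delta vectors are orthogonal for both forms. Otherwise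
    the test vector is 1 at [u], [-1 / (deg v - 1)] on the other neighbours of [v], and
    [-1 / (deg u - 1)] on the neighbours of [u] outside the closed neighbourhood of [v]; [1 < deg u]
    keeps the denominators nonzero. *)
Lemma mu2_ge_second u v : u != v -> (1 < deg u)%N -> (deg u <= deg v)%N ->
  (deg u)%:R <= mu2.
Proof.
move=> uv du duv; case: (boolP (G v u)) => [vu|vu]; last first.
  apply: (mu2_ge V_gt1 (y1 := delta v) (y2 := delta u)).
  - by rewrite bform_deltas eqxx adj_irr mulr1 subr0 subr_ge0 ler_nat.
  - by rewrite bform_deltas eqxx adj_irr mulr1 subr0 subrr.
  - by rewrite bform_deltas eq_sym (negPf uv) (negPf vu); rewrite /=; ring.
  - by rewrite sum_delta /delta eq_sym (negPf uv).
  - by rewrite (eq_bigr _ (fun u _ => expr2 _)) sum_delta /delta eqxx.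
  - by rewrite (eq_bigr _ (fun u _ => expr2 _)) sum_delta /delta eqxx.
have uv' : G u v by rewrite adj_sym.
pose A : pred V := fun w => G v w && (w != u).
pose B : pred V := fun w => [&& G u w, w != v & ~~ G v w].
pose C : pred V := fun w => G u w && G v w.
have cA : deg v = #|A|.+1.
  rewrite /degree cardsE (cardD1 u) (_ : u \in G v = true) //; congr _.+1.
  by apply: eq_card => w; rewrite !inE andbC.
have cBC : deg u = (#|C| + #|B|).+1.
  rewrite /degree cardsE (cardD1 v) (_ : v \in G u = true) //; congr _.+1.
  rewrite -[LHS](cardID (G v)); congr (_ + _)%N; apply: eq_card => w;
    rewrite !inE.
    change ((w != v) && G u w && G v w = G u w && G v w).
    by case: (eqVneq w v) => [->|]; rewrite ?adj_irr ?andbF.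
  change ([&& ~~ G v w, w != v & G u w] = [&& G u w, w != v & ~~ G v w]).
  by case: (G v w); rewrite ?andbF //= andbT andbC.
pose al : R := #|A|%:R^-1; pose be : R := (#|C| + #|B|)%:R^-1.
(* The weights on A make the sum of x over N(v) vanish. *)
pose x w : R := (w == u)%:R * 1 + ((A w)%:R * (- al) + (B w)%:R * (- be)).
have AuF : A u = false by rewrite /A /= eqxx andbF.
have BuF : B u = false by rewrite /B /= adj_irr.
have BvF : B v = false by rewrite /B /= eqxx andbF.
have AvF : A v = false by rewrite /A /= adj_irr.
have BA w : A w -> B w = false by rewrite /A /B /= => /andP[-> _];
  rewrite !andbF.
have x_v : x v = 0 by rewrite /x AvF BvF eq_sym (negPf uv); rewrite /=; ring.
have x_u : x u = 1 by rewrite /x AuF BuF eqxx; rewrite /=; ring.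
have nA0 : #|A|%:R != 0 :> R by rewrite pnatr_eq0; lia.
have nB0 : (#|C| + #|B|)%:R != 0 :> R by rewrite pnatr_eq0; lia.
have norm : \sum_w x w ^+ 2 = 1 + (#|A|%:R * al ^+ 2 + #|B|%:R * be ^+ 2).
  rewrite -!sum_ind -[X in _ = X + _](sum_delta (R := R) u (fun=> 1))
    -!big_split /=.
  apply: eq_bigr => w _; rewrite /x /delta.
  case: (eqVneq w u) => [->|wu]; first (rewrite AuF BuF /=; ring).
  case: (boolP (A w)) => [/BA->|_]; first by rewrite /=; ring.
  by case: (B w); rewrite /=; ring.
have lbv : \sum_(w | G v w) (x v - x w) ^+ 2 = 1 + #|A|%:R * al ^+ 2.
  rewrite (bigD1 u) //= x_u x_v sub0r sqrrN expr1n -sum_ind; congr (_ + _).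
  rewrite [RHS]big_mkcond [LHS]big_mkcond /=; apply: eq_bigr => w _.
  rewrite -[G v w && _]/(A w) /x sub0r sqrrN; case: (boolP (A w)) => [Aw|];
    last by rewrite mul0r.
  rewrite (BA _ Aw); case/andP: Aw => _ /negPf->; rewrite /=; ring.
have lbu : \sum_(w | G u w && (w != v)) (x u - x w) ^+ 2 =
   #|C|%:R * (1 + al) ^+ 2 + #|B|%:R * (1 + be) ^+ 2.
  rewrite -!sum_ind -big_split /= [LHS]big_mkcond /=; apply: eq_bigr => w _.
  rewrite x_u /x /A /B /C /=.
  case: (eqVneq w v) => [->|wv] /=.
    by rewrite adj_irr !andbF; rewrite /=; ring.
  case: (eqVneq w u) => [->|wu] /=; first by rewrite adj_irr /=; ring.
  by case: (G u w); case: (G v w) => /=; rewrite /=; ring.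
apply: (mu2_ge_star (v := v) (x := x)) => //.
- rewrite lapE x_v mulr0 sub0r (bigD1 u) //= x_u.
  have -> : \sum_(w | G v w && (w != u)) x w = \sum_w (A w)%:R * (- al).
    rewrite big_mkcond /=; apply: eq_bigr => w _; rewrite -[G v w && _]/(A w).
    case: (boolP (A w)) => [Aw|]; last by rewrite mul0r.
    by rewrite /x Aw (BA _ Aw); case/andP: Aw => _ /negPf->; rewrite /=; ring.
  by rewrite sum_ind mulrN mulfV // subrr oppr0.
- by rewrite ler_nat.
- rewrite (bform_shift _ _ 0) norm.
  have := edge_form_lb x uv; rewrite lbv lbu.
  have Aal : #|A|%:R * al = 1 by rewrite mulfV.
  have Bbe : (#|C|%:R + #|B|%:R) * be = 1 by rewrite -natrD mulfV.
  have al0 : 0 <= al by rewrite invr_ge0.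
  have cab : (#|C| + #|B| <= #|A|)%N by rewrite -ltnS -cBC -cA.
  have cb0 : (0 < #|C| + #|B|)%N by rewrite -ltnS -cBC.
  have albe : al <= be.
    by rewrite lef_pV2 ?posrE ?ltr0n ?ler_nat // (leq_trans cb0).
  have -> : (deg u)%:R = 1 + (#|C|%:R + #|B|%:R) :> R.
    by rewrite cBC -addn1 addnC !natrD.
  have -> : #|A|%:R * al ^+ 2 = al by rewrite expr2 mulrA Aal mul1r.
  exact: second_arith.
by rewrite norm ltr_wpDr // addr_ge0 // mulr_ge0 // sqr_ge0.
Qed.

End TestVectors.

(** * Regular graphs in which [mu2] does not exceed the degree *)

Section RegularCase.

Variables (R : rcfType) (V : finType) (G : sgraph V) (d : nat).
Hypothesis V_gt1 : (1 < #|V|)%N.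
Hypothesis d_gt0 : (0 < d)%N.
Hypothesis regG : forall u, degree G u = d.
Local Notation mu2 := ('mu[R]_2(G)).
Local Notation delta := (@delta R V).
Local Notation pair := (@pair R V).

(** The diagonal entries cancel at [t = d], leaving minus the adjacency matrix, so the Gram matrices
    below have small integer entries. *)
Lemma bform_deltas_regular a b :
  bform G d%:R (delta a) (delta b) = - (G a b)%:R.
Proof. by rewrite bform_deltas regG subrr mul0r sub0r. Qed.

Lemma bform_pair_regular a b : G a b -> bform G d%:R (pair a b) (pair a b) = 2.
Proof.
by move=> ab; rewrite bform_pair_diag ?(adj_neq ab) // !regG ab /=; ring.
Qed.

(** The Gram matrix has diagonal entries 2 and off-diagonal entries 1. *)
Lemma mu2_gt_triangle a b c : G a b -> G b c -> G a c -> d%:R < mu2.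
Proof.
move=> ab bc ac; apply: (mu2_gt V_gt1 (y1 := pair a b) (y2 := pair a c));
  rewrite ?(bform_pair_regular ab) ?(bform_pair_regular ac) //.
rewrite bform_pair !bform_deltas_regular adj_irr [G b a]adj_sym ab ac bc /=;
  lra.
Qed.

(** The Gram matrix has diagonal entries 2 and off-diagonal entry [G v z - G u z], at most 1 in
    absolute value. *)
Lemma mu2_gt_far_edge v u w z : G v u -> G w z -> ~~ G v w -> ~~ G u w ->
  d%:R < mu2.
Proof.
move=> vu wz vw uw; apply: (mu2_gt V_gt1 (y1 := pair v u) (y2 := pair w z));
  rewrite ?(bform_pair_regular vu) ?(bform_pair_regular wz) //.
rewrite bform_pair !bform_deltas_regular (negPf vw) (negPf uw).
by case: (G v z); case: (G u z) => /=; lra.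
Qed.

Lemma regular_bipartite v : ~ d%:R < mu2 ->
  forall x y, G x y = (G v x != G v y).
Proof.
move=> nlt.
have nbr w : exists z, G w z.
  have : (0 < degree G w)%N by rewrite regG.
  by case/card_gt0P => z; rewrite inE; exists z.
(* Every vertex [c] is adjacent to exactly one end of each edge: two would give a triangle, and with
   none any edge at [c] is far from [ab]. *)
have edge a b c : G a b -> G b c = ~~ G a c.
  move=> ab; case: (boolP (G a c)) => ac /=.
    by apply/negP => bc; apply: nlt; apply: (mu2_gt_triangle ab bc ac).
  apply/negPn/negP => bc; have [z cz] := nbr c; apply: nlt.
  exact: (mu2_gt_far_edge ab cz ac bc).
move=> x y; case: (boolP (G v x)) => vx; first by rewrite (edge _ _ _ vx).
have [u vu] := nbr v.
have ux : G u x by rewrite (edge _ _ _ vu).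
by rewrite (edge _ _ _ ux) (edge _ _ _ vu) negbK.
Qed.

End RegularCase.

(** * Fan vectors, supported on an independent set of neighbours of [v] and one or two further
    vertices *)

Section LargeDegree.

Variables (R : rcfType) (V : finType) (G : sgraph V).
Hypothesis V_gt1 : (1 < #|V|)%N.
Local Notation mu2 := ('mu[R]_2(G)).
Local Notation deg := (degree G).
Local Notation lap := (lap G).
Local Notation bform := (bform G).

Lemma sum_adj u (x : V -> R) : \sum_(w | G u w) x w = \sum_w (G u w)%:R * x w.
Proof.
rewrite big_mkcond /=; apply: eq_bigr => w _.
by case: (G u w); rewrite ?mul1r ?mul0r.
Qed.

(* The test vector is al on A, be on B and -1 at w. *)
Lemma mu2_gt_fan (F : {set V}) (d : nat) v w (t al be : R) :
  let A : pred V := fun u => (u \in F) && G w u in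
  let B : pred V := fun u => (u \in F) && ~~ G w u in
  (forall u, u \in F -> G v u) -> (forall u, u \in F -> deg u = d) ->
  {in F &, forall u u', ~~ G u u'} -> w \notin F -> w != v ->
  t < (deg v)%:R -> #|A|%:R * al + #|B|%:R * be = (G v w)%:R ->
  0 < (d%:R - t) * (#|A|%:R * al ^+ 2 + #|B|%:R * be ^+ 2) + 2 * (#|A|%:R * al)
      + (deg w)%:R - t ->
  t < mu2.
Proof.
move=> A B Fv Fd Find wF wv tv sum0 pos.
pose x u : R := (A u)%:R * al + ((B u)%:R * be + (u == w)%:R * (-1)).
have vF : v \notin F by apply/negP => /Fv; rewrite adj_irr.
have x_v : x v = 0 by rewrite /x /A /B /= (negPf vF) eq_sym (negPf wv) /=; ring.
have x_w : x w = -1 by rewrite /x /A /B /= (negPf wF) eqxx /=; ring.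
have sum_nw u : \sum_z (z == w)%:R * ((-1) * (G u z)%:R) = - (G u w)%:R :> R.
  by rewrite (sum_delta w (fun z => (-1) * (G u z)%:R)) mulN1r.
have lap_v : lap x v = 0.
  rewrite lapE x_v mulr0 sub0r sum_adj; apply/eqP; rewrite oppr_eq0; apply/eqP.
  transitivity (#|A|%:R * al + (#|B|%:R * be + - (G v w)%:R)); last first.
    by rewrite addrA sum0 subrr.
  rewrite -sum_nw -(sum_ind A) -(sum_ind B) -!big_split /=;
    apply: eq_bigr => u _.
  rewrite /x /A /B /=; case: (boolP (u \in F)) => [/Fv->|_] /=; last by ring.
  by case: (G w u) => /=; ring.
have lap_F u : u \in F -> lap x u = d%:R * x u + (G u w)%:R.
  move=> uF; rewrite lapE Fd //; congr (_ + _); rewrite sum_adj -[RHS]opprK;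
    congr (- _).
  rewrite -sum_nw; apply: eq_bigr => z _.
  rewrite /x /A /B /=; case: (boolP (z \in F)) => [zF|_] /=; last by ring.
  rewrite (negPf (Find _ _ uF zF)) /=; case: eqVneq zF => [->|_ _];
    first by rewrite (negPf wF).
  by rewrite /=; ring.
have lap_w : lap x w = - (deg w)%:R - #|A|%:R * al.
  rewrite lapE x_w mulrN1; congr (_ - _); rewrite sum_adj -sum_ind;
    apply: eq_bigr => z _.
  rewrite /x /A /B /=; case: (eqVneq z w) => [->|_];
    first by rewrite adj_irr andbF /=; ring.
  by case: (z \in F); case: (G w z) => /=; ring.
apply: (mu2_gt_star V_gt1 x_v lap_v tv).
suff -> : bform t x x = (d%:R - t) * (#|A|%:R * al ^+ 2 + #|B|%:R * be ^+ 2)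
  + 2 * (#|A|%:R * al) + (deg w)%:R - t by [].
(* The summands of the form, sorted by the supports [A], [B] and [w]; each edge between [A] and [w]
   contributes [al] from both ends. *)
transitivity (\sum_u (((A u)%:R * ((d%:R - t) * al ^+ 2 + al) +
   (B u)%:R * ((d%:R - t) * be ^+ 2)) +
   (u == w)%:R * ((deg w)%:R + #|A|%:R * al - t))); last first.
  rewrite !big_split /= sum_ind (sum_ind B).
  by rewrite (sum_delta w (fun=> _)); ring.
apply: eq_bigr => u _; case: (eqVneq u w) => [->|uw].
  by rewrite lap_w x_w /A /B /= (negPf wF) /=; ring.
case: (boolP (u \in F)) => uF; last first.
  by rewrite {1}/x /A /B /= (negPf uF) (negPf uw) /=; ring.
rewrite lap_F // /x /A /B /= uF (negPf uw) /= [G u w]adj_sym.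
by case: (G w u) => /=; ring.
Qed.

(* The test vector is 1 on F and -d at both z and w. *)
Lemma mu2_gt_double_fan (F : {set V}) (d : nat) v w z :
  (forall u, u \in F -> [/\ G v u, G w u & ~~ G z u]) ->
  (forall u, u \in F -> deg u = d) ->
  {in F &, forall u u', ~~ G u u'} -> #|F| = d -> (0 < d < deg v)%N ->
  w != v -> ~~ G v w -> ~~ G w z -> G v z -> deg w = d -> (deg z).+1 = d ->
  d%:R < mu2.
Proof.
move=> Fvw Fd Find cF /andP[d0 dv] wv vw wz vz dw dz.
pose x u : R :=
  (u \in F)%:R * 1 + (u == z)%:R * (- d%:R) + (u == w)%:R * (- d%:R).
have vF : v \notin F by apply/negP => /Fvw[]; rewrite adj_irr.
have wF : w \notin F by apply/negP => /Fvw[]; rewrite (negPf vw).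
have zF : z \notin F by apply/negP => zF; have := Fd _ zF; lia.
have zv : z != v by rewrite eq_sym (adj_neq vz).
have zw : z != w by apply: contraNneq vw => <-.
have sumx (g : V -> R) :
  \sum_u g u * x u = \sum_(u in F) g u - d%:R * g z - d%:R * g w.
  rewrite -[d%:R * g z](sum_delta z (fun u => d%:R * g u)).
  rewrite -[d%:R * g w](sum_delta w (fun u => d%:R * g u)).
  rewrite [\sum_(u in F) _]big_mkcond -!sumrB /=; apply: eq_bigr => u _.
  by rewrite /x /delta; case: (u \in F) => /=; ring.
have sumF (g : V -> R) (c : R) :
  (forall u, u \in F -> g u = c) -> \sum_(u in F) g u = d%:R * c.
  by move=> gc; rewrite (eq_bigr (fun=> c)) // sumr_const cF mulr_natl.
have x_v : x v = 0.
  by rewrite /x (negPf vF) eq_sym (negPf zv) eq_sym (negPf wv) /=; ring.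
have x_w : x w = - d%:R.
  by rewrite /x (negPf wF) eqxx eq_sym (negPf zw) /=; ring.
have x_z : x z = - d%:R.
  by rewrite /x (negPf zF) eqxx (negPf zw) /=; ring.
have lap_v : lap x v = 0.
  rewrite lapE x_v sum_adj sumx (sumF _ 1) => [|u /Fvw[-> //]].
  by rewrite vz (negPf vw) /=; ring.
apply: (mu2_gt_star V_gt1 x_v lap_v); first by rewrite ltr_nat.
have lapF u : u \in F -> lap x u - d%:R * x u = d%:R.
  move=> uF; have [uv uw uz] := Fvw u uF.
  rewrite lapE sum_adj sumx (sumF _ 0) => [|u' u'F]; last first.
    by rewrite (negPf (Find _ _ uF u'F)).
  by rewrite [G u z]adj_sym [G u w]adj_sym uw (negPf uz) Fd //=; ring.
have lapw : lap x w - d%:R * x w = - d%:R.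
  rewrite lapE sum_adj sumx (sumF _ 1) => [|u /Fvw[_ -> //]].
  by rewrite adj_irr (negPf wz) dw /=; ring.
have lapz : lap x z - d%:R * x z = d%:R.
  rewrite lapE sum_adj sumx (sumF _ 0) => [|u /Fvw[_ _ /negPf-> //]].
  rewrite adj_irr [G z w]adj_sym (negPf wz) x_z -dz -addn1 natrD /=; ring.

have -> : bform d%:R x x = \sum_u (lap x u - d%:R * x u) * x u.
  by apply: eq_bigr => u _; rewrite mulrC.
rewrite sumx (sumF _ _ lapF) lapw lapz.
have : 0 < d%:R :> R by rewrite ltr0n.
nra.
Qed.

(* With e = 0, the choice al = tau / a, be = - tau / b turns the quantity into
   2 tau - del tau^2 (a + b) / (a b) - s - del, which is maximal at
   tau = a b / (del (a + b)); for e = 1 both weights are shifted by 1 / (a + b),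
   which only helps. *)
Lemma fan_arith (a b s del e : R) :
  1 <= a -> 1 <= b -> 0 <= s -> 0 <= del <= 2 ->
  del * (del + s) * (a + b) < a * b -> e = 0 \/ e = 1 ->
  exists al be, a * al + b * be = e /\
    0 < - del * (a * al ^+ 2 + b * be ^+ 2) + 2 * (a * al) - s - del.
Proof.
move=> a1 b1 s0 /andP[del0 del2] small he.
have aN0 : a != 0 by rewrite gt_eqF // (lt_le_trans ltr01).
have bN0 : b != 0 by rewrite gt_eqF // (lt_le_trans ltr01).
have ab0 : 0 < a + b by rewrite addr_gt0 // (lt_le_trans ltr01).
have abN0 : a + b != 0 by rewrite gt_eqF.
have p0 : 0 < a * b by rewrite mulr_gt0 // (lt_le_trans ltr01).
have [tau htau] : exists tau,
    0 < 2 * tau - del * tau ^+ 2 * (a + b) / (a * b) - s - del.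
  (* At [del = 0] there is no maximiser, but the expression is linear in [tau] and any large value
     serves. *)
  case: (eqVneq del 0) => [->|delN0].
    by exists (s + 1); rewrite !mul0r subr0; lra.
  have dpos : 0 < del by rewrite lt0r delN0.
  exists (a * b / (del * (a + b))).
  have -> : 2 * (a * b / (del * (a + b))) -
     del * (a * b / (del * (a + b))) ^+ 2 * (a + b) / (a * b) - s - del =
     (a * b - del * (del + s) * (a + b)) / (del * (a + b)).
    by field; rewrite delN0 abN0 aN0 bN0.
  by rewrite divr_gt0 ?subr_gt0 // mulr_gt0.
exists ((e * a / (a + b) + tau) / a), ((e * b / (a + b) - tau) / b); split.
  by field; rewrite aN0 bN0 abN0.
have e2 : e ^+ 2 = e by case: he => ->; rewrite ?expr0n ?expr1n.
have e0 : 0 <= e by case: he => ->.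
have -> : - del * (a * ((e * a / (a + b) + tau) / a) ^+ 2 +
    b * ((e * b / (a + b) - tau) / b) ^+ 2) +
    2 * (a * ((e * a / (a + b) + tau) / a))
    - s - del =
  (2 * tau - del * tau ^+ 2 * (a + b) / (a * b) - s - del) +
  (2 * e * a - del * e ^+ 2) / (a + b).
  by field; rewrite aN0 bN0 abN0.
rewrite ltr_wpDr // divr_ge0 ?(ltW ab0) // e2.
have -> : 2 * e * a - del * e = e * (2 * a - del) by ring.
by rewrite mulr_ge0 // subr_ge0; lra.
Qed.

End LargeDegree.

(** Here [x] is the excess of the average degree over [d] and [f] is [|F|]; the conclusion is the
    fan condition for a vertex [w] of degree [d], with [a (f - a)] replaced by its minimum [f - 1]
    over the integers [0 < a < f]. *)
Lemma small_excess (R : realFieldType) (x f : R) :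
  2 <= f -> 0 <= x -> x < 1 -> (f + 2) * x <= f - 2 -> x * x * f < f - 1.
Proof.
move=> f2 x0 x1 fx.
have : x * x * f <= x * f by rewrite ler_wpM2r ?ler_piMr //; lra.
nra.
Qed.

(** The analogue for [w] of degree [d - 1], whose deficit 1 enters through the factor [x + 1]. *)
Lemma small_excess1 (R : realFieldType) (x f : R) :
  2 <= f -> 0 <= x -> (2 * f + 1) * x <= f - 2 -> x * (x + 1) * f < f - 1.
Proof.
move=> f2 x0 fx; have x2 : 2 * x <= 1 by nra.
have xf : 0 <= x * f by rewrite mulr_ge0 //; lra.
have : x * (x + 1) * f <= (3 / 2) * (x * f).
  have -> : x * (x + 1) * f = (x + 1) * (x * f) by ring.
  by rewrite ler_wpM2r //; lra.
nra.
Qed.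

(** * A unique vertex of maximum degree, with average degree at least [d] *)

Section UniqueMaximum.

Variables (R : rcfType) (V : finType) (G : sgraph V) (v : V) (d : nat).
Hypothesis V_gt1 : (1 < #|V|)%N.
Local Notation mu2 := ('mu[R]_2(G)).
Local Notation deg := (degree G).
Local Notation n := #|V|.
Hypothesis deg_le : forall w, w != v -> (deg w <= d)%N.
Hypothesis d_ge2 : (1 < d)%N.
Hypothesis deg_v : (d < deg v)%N.
Let S := (\sum_u deg u)%N.
Hypothesis avg_ge : (n * d <= S)%N.

Let F := [set w | G v w & deg w == d].
(** The candidates for the vertex [w] of a fan. *)
Let W := [set w | [&& w \notin F, w != v & [exists u in F, G w u]]].
(* [e w] is the defect of w: how far deg w is below d, with one unit forgiven to
   the neighbours of v outside F. *)
Let e w := (d - deg w - (G v w && (deg w < d)))%N.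

(** For [w != v] one has [deg w + e w + G v w = d + (w \in F)]; on summation the adjacency
    indicators give back [deg v]. Thus the excess of the degree sum over [n d], plus the total
    defect, is [|F| - d]. *)
Lemma fan_sum_deg : (S + \sum_(w | w != v) e w + d = n * d + #|F|)%N.
Proof.
have E : (\sum_(w | w != v) (deg w + e w + G v w) =
          \sum_(w | w != v) (d + (w \in F)))%N.
  apply: eq_bigr => w wv; rewrite /e inE; have := deg_le wv.
  case: (G v w) => /=; case: (ltngtP (deg w) d) => //= h _; move: h; lia.
have Sv : (S = deg v + \sum_(w | w != v) deg w)%N by rewrite /S (bigD1 v).
have vsum (P : pred V) : ~~ P v -> (\sum_(w | w != v) P w = #|P|)%N.
  move=> Pv; rewrite -sum1_card [RHS]big_mkcond [RHS](bigD1 v) //= unfold_in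
    (negPf Pv).
  by rewrite add0n; apply: eq_bigr => w _; rewrite unfold_in; case: (P w).
have cv : (\sum_(w | w != v) G v w = deg v)%N.
  by rewrite vsum ?adj_irr // /degree cardsE.
have cF : (\sum_(w | w != v) (w \in F) = #|F|)%N.
  by rewrite vsum //= ?inE ?adj_irr.
have cd : (\sum_(w | w != v) d = (n - 1) * d)%N.
  by rewrite sum_nat_const -[#|[pred w | w != v]|]/(#|predC1 v|) cardC1 subn1.
move: E; rewrite !big_split /= cv cF cd.
have : (n * d = (n - 1) * d + d)%N by rewrite -mulSnr subn1 prednK // ltnW.
by rewrite Sv => -> H;
  rewrite (addnC (deg v)) [(_ + deg v + _)%N]addnAC H addnAC.
Qed.

Let t : R := S%:R / n%:R.
(** The excess of the average degree over [d]; it lies in [[0, 1)]. *)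
Let del : R := t - d%:R.

Lemma n_gt0 : 0 < n%:R :> R. Proof. by rewrite ltr0n ltnW. Qed.

Lemma nt_eq : n%:R * t = S%:R.
Proof. by rewrite /t mulrCA mulfV ?mulr1 // gt_eqF // n_gt0. Qed.

Lemma ndel_eq : n%:R * del = S%:R - n%:R * d%:R.
Proof. by rewrite /del mulrBr nt_eq. Qed.

Lemma del_ge0 : 0 <= del.
Proof.
by rewrite -(pmulr_rge0 _ n_gt0) ndel_eq -natrM subr_ge0 ler_nat.
Qed.

Lemma ndel_le : n%:R * del + (\sum_(w | w != v) e w)%:R <= #|F|%:R - d%:R.
Proof.
have := congr1 (fun k => k%:R : R) fan_sum_deg.
by rewrite ndel_eq !natrD natrM; lra.
Qed.

Lemma F_ge_d : (d <= #|F|)%N.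
Proof. by have := fan_sum_deg; move: avg_ge; lia. Qed.

Lemma F_lt_n : (#|F| < n)%N.
Proof.
rewrite -(cardsT V) proper_card // properT; apply/eqP => FT.
by have := in_setT v; rewrite -FT inE adj_irr.
Qed.

Lemma del_lt1 : del < 1.
Proof.
rewrite -(ltr_pM2l n_gt0) mulr1.
have h1 : (#|F|%:R < n%:R :> R) by rewrite ltr_nat F_lt_n.
have h2 : 0 <= (\sum_(w | w != v) e w)%:R :> R by [].
have h3 : 0 <= d%:R :> R by [].
have := ndel_le; lra.
Qed.

Lemma avg_lt_max : t < (deg v)%:R.
Proof.
have h : (d.+1%:R <= (deg v)%:R :> R) by rewrite ler_nat.
move: h; rewrite -addn1 natrD; have := del_lt1; rewrite /del; lra.
Qed.

(** For an edge [u u'] inside [F], the vector [pair u u'] is orthogonal to [delta v] for both forms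
    and its value [2 d + 2 - 2 t] is positive because [del < 1]. *)
Lemma fan_or_edge : t < mu2 \/ {in F &, forall u u', ~~ G u u'}.
Proof.
case: (boolP [exists u in F, [exists u' in F, G u u']]) => [|indep]; last first.
  right=> u u' uF u'F; apply: contra indep => uu'.
  by apply/existsP; exists u; rewrite uF; apply/existsP; exists u'; rewrite u'F.
case/existsP=> u /andP[uF /existsP[u' /andP[u'F uu']]]; left.
move: uF u'F; rewrite !inE => /andP[vu /eqP du] /andP[vu' /eqP du'].
have p0 : pair R u u' v = 0.
  by rewrite /pair /delta (negPf (adj_neq vu)) (negPf (adj_neq vu')) /=; ring.
apply: (mu2_gt_star V_gt1 p0 _ avg_lt_max).
  by rewrite lap_pair p0 vu vu' /=; ring.
rewrite bform_pair_diag ?(adj_neq uu') // du du' uu' /=.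
have := del_lt1; rewrite /del; lra.
Qed.

Hypothesis F_indep : {in F &, forall u u', ~~ G u u'}.

(** [fan_arith] supplies the weights, with [s = d - deg w] and [e] the adjacency of [v] and [w];
    both parts of the fan are nonempty since [0 < a < |F|]. *)
Lemma fan_gt w (a := #|[pred u | (u \in F) && G w u]|) : w \in W ->
  (a < #|F|)%N ->
  del * (del + (d - deg w)%:R) * #|F|%:R < a%:R * (#|F| - a)%:R -> t < mu2.
Proof.
rewrite inE => /and3P[wF wv /existsP[u0 /andP[u0F wu0]]] aF small.
pose b := #|[pred u | (u \in F) && ~~ G w u]|.
have ab : (#|F| = a + b)%N.
  rewrite -[LHS](cardID (G w)); congr (_ + _)%N; apply: eq_card => u.
  exact: andbC.
have a1 : (0 < a)%N by apply/card_gt0P; exists u0; rewrite inE u0F.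
have b1 : (0 < b)%N by move: aF; rewrite ab; lia.
have small' : del * (del + (d - deg w)%:R) * (a%:R + b%:R) < a%:R * b%:R.
  by move: small; rewrite ab addKn natrD.
have [|||||al [be [sum0 pos]]] :=
  @fan_arith R a%:R b%:R (d - deg w)%:R del (G v w)%:R _ _ _ _ small' _.
- by rewrite ler1n.
- by rewrite ler1n.
- by [].
- by rewrite del_ge0 (le_trans (ltW del_lt1)) // ler1n.
- by case: (G v w); [right | left].
apply: (mu2_gt_fan V_gt1 (F := F) (d := d) (v := v) (w := w) (al := al)
  (be := be)) => //.
- by move=> u; rewrite inE => /andP[].
- by move=> u; rewrite inE => /andP[_ /eqP].
- exact: avg_lt_max.
apply: (lt_le_trans pos).
rewrite natrB ?deg_le // -[X in X <= _]addr0.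
by rewrite -/a -/b /del le_eqVlt; apply/orP; left; apply/eqP; ring.
Qed.

(* Double counting of the edges between F and W: F is independent, so each of
   its vertices has all its neighbours but v in W. *)
Lemma W_sum_le (r : nat) : {in W, forall w, (deg w <= r)%N} ->
  (#|F| * (d - 1) <= #|W| * r)%N.
Proof.
move=> Wr; rewrite -!sum_nat_const.
apply: (@leq_trans (\sum_(w in W) \sum_(u in F) G w u)); last first.
  apply: leq_sum => w wW; apply: leq_trans (Wr w wW).
  rewrite -[X in (_ <= X)%N]sum1_card [X in (_ <= X)%N]big_mkcond /=.
  rewrite big_mkcond /=; apply: leq_sum => u _; rewrite inE.
  by case: (u \in F); case: (G w u).
rewrite exchange_big /=; apply: leq_sum => u uF.
have [vu /eqP du] : G v u /\ deg u == d by apply/andP; move: uF; rewrite inE.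
rewrite -du /degree (cardsD1 v) inE [G u v]adj_sym vu add1n subn1 /=.
rewrite -sum1_card big_mkcond [X in (_ <= X)%N]big_mkcond /=.
apply: leq_sum => w _; rewrite !inE [G u w]adj_sym.
case: (eqVneq w v) => //= wv; case: (boolP (G w u)) => //= wu.
case: (boolP (w \in F)) => [wF|wF].
  by have := F_indep wF uF; rewrite wu.
move: wF; rewrite inE => -> /=.
by case: existsP => // -[]; exists u; rewrite uF.
Qed.

Lemma card_VFW : (#|W| + #|F| + 1 <= n)%N.
Proof.
have vF : v \notin F by rewrite inE adj_irr.
have vW : v \notin W by rewrite inE eqxx andbF.
have dis : [disjoint W & F].
  by rewrite disjoints_subset; apply/subsetP => w; rewrite !inE => /andP[].
have -> : (#|W| + #|F| + 1 = #|v |: (W :|: F)|)%N.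
  by rewrite cardsU1 inE negb_or vF vW addnC cardsU disjoint_setI0 // cards0
    subn0.
exact: max_card.
Qed.

Lemma fan_nbr_le w : (#|[pred u | (u \in F) && G w u]| + G v w <= deg w)%N.
Proof.
rewrite /degree (cardsD1 v) inE [G w v]adj_sym addnC leq_add2l.
apply/subset_leq_card/subsetP => u; rewrite !inE => /andP[/andP[vu _] ->].
by rewrite eq_sym (adj_neq vu).
Qed.

Lemma fan_nbr_gt0 w : w \in W -> (0 < #|[pred u | (u \in F) && G w u]|)%N.
Proof.
rewrite inE => /and3P[_ _ /existsP[u uP]].
by apply/card_gt0P; exists u; rewrite inE.
Qed.

(* If w sees all of F then |F| = d and the average is exactly d; a neighbour z
   of v outside F then provides either another fan or the second centre of a
   double fan. *)
Lemma fan_gt_full w : w \in W -> deg w = d -> t < mu2.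
Proof.
move=> wW dw; have a0 := fan_nbr_gt0 wW; have aF := fan_nbr_le w.
move: (wW); rewrite inE => /and3P[wF wv wFe].
have vw : ~~ G v w by apply: contra wF => vw; rewrite inE vw dw eqxx.
have W1 : (0 < #|W|)%N by apply/card_gt0P; exists w.
case: (ltnP #|[pred u | (u \in F) && G w u]| #|F|) => [aLF|Fa].
  apply: (fan_gt wW aLF); rewrite dw subnn addr0.
  move: a0 aLF card_VFW; set a := #|_| => a0 aLF nVFW.
  (* Two positive integers of sum [|F|] have product at least [|F| - 1]. *)
  have h1 : a%:R * (#|F| - a)%:R >= (#|F|%:R - 1 : R).
    rewrite -natrM -[1]/(1%:R) -natrB ?ler_nat; last by lia.
    have [k ->] : exists k, (#|F| = a + k.+1)%N by exists (#|F| - a).-1; lia.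
    by rewrite addKn; nia.
  apply: lt_le_trans h1.
  (* The distinct vertices [v] and [w] lie outside [F]. *)
  have h2 : (#|F|%:R + 2 <= n%:R :> R) by rewrite -natrD ler_nat; lia.
  have h3 : (2 <= d%:R :> R) by rewrite ler_nat.
  have h4 : (d%:R <= #|F|%:R :> R) by rewrite ler_nat F_ge_d.
  have h5 : 0 <= (\sum_(w | w != v) e w)%:R :> R by [].
  have h6 := ndel_le.
  have h7 := del_ge0; have h8 := del_lt1.
  have h9 : (#|F|%:R + 2) * del <= #|F|%:R - 2.
    apply: le_trans (_ : n%:R * del <= _); first by rewrite ler_wpM2r.
    by move: h6; lra.
  by apply: small_excess; rewrite ?(le_trans h3).
have vw0 : G v w = false by exact: negbTE.
have Fd : #|F| = d.
  by have := F_ge_d; move: aF; rewrite vw0 dw; lia.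
have FNw : F = [set u | G w u].
  apply/eqP; rewrite -[_ == _](geq_leqif (subset_leqif_cards _)).
    by rewrite -/(deg w) dw Fd.
  apply/subsetP => u uF; rewrite inE.
  have cE : #|[pred u | (u \in F) && G w u]| = #|F|.
    apply/eqP; rewrite eqn_leq Fa andbT; apply: subset_leq_card.
    by apply/subsetP => x /andP[].
  have sub : [pred u | (u \in F) && G w u] \subset F.
    by apply/subsetP => x /andP[].
  by have := subset_cardP cE sub u; rewrite uF => /andP[].
have sum_eq := fan_sum_deg.
(* With [|F| = d] the count in [fan_sum_deg] is tight: there is no defect and the average is exactly
   [d]. *)
have e0 : (\sum_(w | w != v) e w = 0)%N by move: sum_eq avg_ge; rewrite Fd; lia.
have Snd : S = (n * d)%N by move: sum_eq; rewrite Fd e0; lia.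
have td : t = d%:R by rewrite /t Snd natrM mulrC mulKf // gt_eqF // n_gt0.
have del0 : del = 0 by rewrite /del td subrr.
(* Such a [z] exists because [deg v > d = |F|]. *)
have [z] : exists z, z \in [set u | G v u] :\: F.
  apply/card_gt0P; have := cardsID F [set u | G v u].
  rewrite -/(deg v) (_ : _ :&: F = F) ?Fd; first by move: deg_v; lia.
  by apply/setIidPr/subsetP => u; rewrite !inE => /andP[].
rewrite !inE => /andP[+ vz]; rewrite vz /= => dz.
have zv : z != v by rewrite eq_sym (adj_neq vz).
have zF : z \notin F by rewrite inE vz.
(* A neighbour of [v] outside [F] without defect is exactly one short of [d]. *)
have dz1 : (deg z).+1 = d.
  have : e z = 0%N by move/eqP: e0; rewrite sum_nat_eq0 => /forallP/(_ z);
    rewrite zv => /eqP.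
  rewrite /e vz ltn_neqAle dz deg_le //=.
  by have := deg_le zv; move: dz; lia.
case: (boolP [exists u in F, G z u]) => [zW|zNW].
  have zW' : z \in W by rewrite inE zF zv.
  have := fan_nbr_le z; have := fan_nbr_gt0 zW'; set a := #|_| => az0 az.
  have azF : (a < #|F|)%N by rewrite Fd -dz1 ltnS (leq_trans (leq_addr _ _) az).
  apply: (fan_gt zW' azF).
  by rewrite del0 !mul0r -natrM ltr0n muln_gt0 az0 subn_gt0.
rewrite td; apply: (@mu2_gt_double_fan R V G V_gt1 F d v w z) => //.
- move=> u uF; split; first by move: uF; rewrite inE => /andP[].
    by move: uF; rewrite FNw inE.
  by apply: contra zNW => zu; apply/existsP; exists u; rewrite uF.
- by move=> u; rewrite inE => /andP[_ /eqP].
- by rewrite deg_v andbT ltnW.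
- by apply: contra zF => wz; rewrite FNw inE.
Qed.

(** If no vertex of [W] has degree [d], double counting gives [|F| <= |W|]. Not all of [W] can have
    degree below [d - 1], since each such vertex has a positive defect and the total defect is at
    most [|F| - d]. A vertex of degree [d - 1] then works, as [n >= 2 |F| + 1]. *)
Lemma mu2_gt_indep : t < mu2.
Proof.
case: (boolP [exists w in W,
  deg w == d]) => [/existsP[w /andP[wW /eqP dw]]|noW].
  exact: (fan_gt_full wW dw).
have Wlt w : w \in W -> (deg w <= d - 1)%N.
  move=> wW; have wv : w != v by move: wW; rewrite inE => /and3P[].
  have : deg w != d by apply: contra noW => dw; apply/existsP; exists w;
    rewrite wW.
  by have := deg_le wv; lia.
have WF : (#|F| <= #|W|)%N.
  have := W_sum_le Wlt; rewrite leq_pmul2r //; by move: d_ge2; lia.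
have [w wW dw] : exists2 w, w \in W & deg w = (d - 1)%N.
  case: (boolP [exists w in W, deg w == (d - 1)%N]).
    by case/existsP => w /andP[wW /eqP dw]; exists w.
  move=> no; exfalso.
  have : (#|W| <= \sum_(w | w != v) e w)%N.
    rewrite -sum1_card big_mkcond [X in (_ <= X)%N]big_mkcond /=.
    apply: leq_sum => w _; case: (boolP (w \in W)) => // wW.
    have wv : w != v by move: wW; rewrite inE => /and3P[].
    have : deg w != (d - 1)%N by apply: contra no => dw; apply/existsP;
      exists w; rewrite wW.
    rewrite wv /e; have := Wlt w wW; move: d_ge2.
    by case: (_ && _) => /=; lia.
  by have := fan_sum_deg; move: avg_ge d_ge2 WF; lia.
have aF := fan_nbr_le w; have a0 := fan_nbr_gt0 wW.
have Fd := F_ge_d.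
have aLF : (#|[pred u | (u \in F) && G w u]| < #|F|)%N.
  by move: aF; rewrite dw; lia.
apply: (fan_gt wW aLF); rewrite dw (_ : (d - (d - 1) = 1)%N); last by lia.
move: a0 aLF card_VFW; set a := #|_| => a0 aLF nVFW.
have h1 : a%:R * (#|F| - a)%:R >= (#|F|%:R - 1 : R).
  rewrite -natrM -[1]/(1%:R) -natrB ?ler_nat; last by lia.
  have [k ->] : exists k, (#|F| = a + k.+1)%N by exists (#|F| - a).-1; lia.
  by rewrite addKn; nia.
apply: lt_le_trans h1.
have h2 : (2 * #|F|%:R + 1 <= n%:R :> R).
  by rewrite -natrM natr1 ler_nat; lia.
have h3 : (2 <= d%:R :> R) by rewrite ler_nat.
have h4 : (d%:R <= #|F|%:R :> R) by rewrite ler_nat F_ge_d.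
have h5 : 0 <= (\sum_(w | w != v) e w)%:R :> R by [].
have h6 := ndel_le.
have h7 := del_ge0.
have h9 : (2 * #|F|%:R + 1) * del <= #|F|%:R - 2.
  apply: le_trans (_ : n%:R * del <= _); first by rewrite ler_wpM2r.
  by move: h6; lra.
by apply: small_excess1; rewrite ?(le_trans h3).
Qed.

End UniqueMaximum.

Lemma mu2_gt_unique_max (R : rcfType) (V : finType) (G : sgraph V) (v : V) (d :
  nat) :
  (1 < #|V|)%N -> (forall w, w != v -> (degree G w <= d)%N) -> (1 < d)%N ->
  (d < degree G v)%N -> (#|V| * d <= \sum_u degree G u)%N ->
  (\sum_u degree G u)%:R / #|V|%:R < 'mu[R]_2(G).
Proof.
move=> V1 dle d2 dv avg.
have [//|indep] := @fan_or_edge R V G v d V1 dle d2 dv avg.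
exact: mu2_gt_indep indep.
Qed.

(** Ordered adjacent pairs are grouped by their underlying edge, and each fibre has two elements. *)
Lemma sum_degree (V : finType) (G : sgraph V) :
  (\sum_u degree G u = 2 * num_edges G)%N.
Proof.
pose P := [set p : V * V | G p.1 p.2].
have -> : (\sum_u degree G u = \sum_(p in P) 1)%N.
  transitivity (\sum_u \sum_(w | G u w) 1)%N.
    by apply: eq_bigr => u _; rewrite /degree -sum1_card; apply: eq_bigl => w;
      rewrite inE.
  by rewrite pair_big_dep /=; apply: eq_bigl => p; rewrite inE.
pose h (p : V * V) := [set p.1; p.2].
rewrite (partition_big_imset h) /=.
have -> : h @: P = edges G.
  by apply/setP => E; apply/imsetP/imsetP => -[p pP ->]; exists p => //;
     move: pP; rewrite !inE.
rewrite (eq_bigr (fun=> 2)) ?sum_nat_const 1?mulnC //.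
move=> E /imsetP[[a b]]; rewrite inE /= => ab ->.
have aNb := adj_neq ab.
rewrite sum1dep_card -[RHS](_ : #|[set (a, b); (b, a)]| = 2); last first.
  by rewrite cards2 xpair_eqE (negPf aNb).
apply: eq_card => -[x y]; rewrite !inE /= !xpair_eqE; apply/andP/orP => /=.
  case=> xy /eqP E2.
  have xE : x \in [set a; b] by rewrite -E2 !inE eqxx.
  have yE : y \in [set a; b] by rewrite -E2 !inE eqxx orbT.
  have := adj_neq xy; move: xE yE; rewrite !inE.
  by do 2!case/orP => /eqP ->; rewrite ?eqxx //; auto.
case=> /andP[/eqP-> /eqP->]; first by rewrite eqxx.
by rewrite adj_sym ab /h /= setUC.
Qed.

(** * Isomorphism of graphs whose adjacency depends only on vertex colours *)

Section ColouredGraphs.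

Variables (V W K : finType) (G : sgraph V) (H : sgraph W).
Variables (r : rel K) (c' : W -> K).
Hypothesis Hr : forall x y, H x y = r (c' x) (c' y).

Lemma gisom_colouring : G ~=g H -> exists c : V -> K,
  (forall x y, G x y = r (c x) (c y)) /\
  (forall k, #|[set x | c x == k]| = #|[set y | c' y == k]|).
Proof.
case=> f fb Hf; exists (c' \o f); split=> [x y|k]; first by rewrite -Hf Hr.
rewrite -(on_card_preimset (f := f)); last by apply: onW_bij.
by apply: eq_card => x; rewrite !inE.
Qed.

Lemma colouring_gisom (c : V -> K) (w0 : W) :
  (forall x y, G x y = r (c x) (c y)) ->
  (forall k, #|[set x | c x == k]| = #|[set y | c' y == k]|) -> G ~=g H.
Proof.
move=> Gr fib.
pose sV k := enum [set x | c x == k]; pose sW k := enum [set y | c' y == k].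
pose f x := nth w0 (sW (c x)) (index x (sV (c x))).
have sz k : size (sV k) = size (sW k) by rewrite -!cardE fib.
have inV x : x \in sV (c x) by rewrite mem_enum inE.
have lt x : (index x (sV (c x)) < size (sW (c x)))%N by rewrite -sz index_mem.
have cf x : c' (f x) = c x.
  by have := mem_nth w0 (lt x); rewrite mem_enum inE => /eqP.
have finj : injective f.
  move=> x y fxy; have cxy : c x = c y by rewrite -!cf fxy.
  move: (lt x) (inV x) fxy; rewrite /f cxy => ltx xV /eqP.
  rewrite nth_uniq ?enum_uniq ?lt // => /eqP ixy.
  by rewrite -(nth_index x xV) ixy nth_index.
have card : #|W| = #|V|.
  rewrite -sum1_card -[RHS]sum1_card.
  rewrite (partition_big c' predT) //= [RHS](partition_big c predT) //=.
  by apply: eq_bigr => k _; rewrite !sum1dep_card fib.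
exists f; first by apply: inj_card_bij => //; rewrite card.
by move=> x y; rewrite Hr !cf -Gr.
Qed.

End ColouredGraphs.

(** Centre, leaves and isolated vertices get three colours. *)
Definition star_colour p r (s : ('I_1 + 'I_p + 'I_r)%type) : option bool :=
  match s with
  | inl (inl _) => None
  | inl (inr _) => Some true
  | inr _ => Some false
  end.

Definition star_rel : rel (option bool) := fun a b =>
  match a, b with
  | None, Some true | Some true, None => true
  | _, _ => false
  end.

Lemma biclique_colour p (x y : 'I_p + 'I_p) :
  'K_(p, p) x y = (is_inl x != is_inl y).
Proof. by case: x y => x [] y. Qed.

Lemma star_union_colour p r (x y : 'I_1 + 'I_p + 'I_r) :
  ('K_(1, p) :u: r*K1) x y = star_rel (star_colour x) (star_colour y).
Proof. by case: x y => [[]|] x [[]|] y. Qed.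

Lemma card_set_sum (A B : finType) (P : pred (A + B)) :
  #|[set s | P s]| = (#|[set a | P (inl a)]| + #|[set b | P (inr b)]|)%N.
Proof.
rewrite -!sum1dep_card [LHS]big_mkcond big_sumType /=.
by congr (_ + _)%N; rewrite [RHS]big_mkcond.
Qed.

Lemma card_setb (A : finType) (b : bool) : #|[set _ : A | b]| = (b * #|A|)%N.
Proof.
case: b; rewrite ?mul1n ?mul0n; first by rewrite -cardsT; apply: eq_card => x;
  rewrite !inE.
by rewrite -(cards0 A); apply: eq_card => x; rewrite !inE.
Qed.

Lemma card_is_inl p (k : bool) : #|[set s : 'I_p + 'I_p | is_inl s == k]| = p.
Proof.
rewrite card_set_sum /= !card_setb card_ord; case: k => /=; lia.
Qed.

Lemma card_star_colour p r (k : option bool) :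
  #|[set s : 'I_1 + 'I_p + 'I_r | star_colour s == k]| =
  match k with None => 1%N | Some true => p | Some false => r end.
Proof.
rewrite !card_set_sum /= !card_setb !card_ord; case: k => [[]|] /=; lia.
Qed.

(** * Graphs whose edges all meet one vertex *)

Section StarGraphs.

Variables (V : finType) (G : sgraph V) (v : V).
Hypothesis edges_v : forall x y, G x y -> (x == v) || (y == v).

(** Every [w != v] has degree 1 or 0 according to its adjacency to [v], so the other degrees again
    sum to [deg v]. *)
Lemma star_sum_degree : (\sum_u degree G u = 2 * degree G v)%N.
Proof.
rewrite (bigD1 v) //= mul2n -addnn; congr (_ + _)%N.
rewrite [RHS]/degree -sum1dep_card big_mkcond [RHS]big_mkcond /=.
apply: eq_bigr => w _; case: (eqVneq w v) => [->|wv] /=;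
  first by rewrite adj_irr.
case: (boolP (G v w)) => vw.
  apply/eqP/cards1P; exists v; apply/setP => z; rewrite !inE.
  apply/idP/eqP => [wz|->]; last by rewrite adj_sym.
  by have := edges_v wz; rewrite (negPf wv) => /eqP.
apply/eqP; rewrite cards_eq0; apply/eqP/setP => z; rewrite !inE.
apply/negP => wz; have := edges_v wz; rewrite (negPf wv) /= => /eqP zv.
by move: wz; rewrite zv adj_sym (negPf vw).
Qed.

Lemma star_gisom (r : nat) : (degree G v + r + 1 = #|V|)%N ->
  G ~=g 'K_(1, degree G v) :u: r*K1.
Proof.
move=> cV; pose c x := if x == v then None else Some (G v x).
apply: (colouring_gisom (@star_union_colour (degree G v) r) (c := c)).
- exact: (inl (inl ord0)).
- move=> x y; rewrite /c; case: (eqVneq x v) => [->|xv].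
    by case: (eqVneq y v) => [->|yv] /=; [rewrite adj_irr | case: (G v y)].
  case: (eqVneq y v) => [->|yv] /=; first by rewrite adj_sym; case: (G v x).
  transitivity false; last by case: (G v x); case: (G v y).
  by apply/negP => /edges_v; rewrite (negPf xv) (negPf yv).
have cN : #|[set x | c x == None]| = 1%N.
  by apply/eqP/cards1P; exists v; apply/setP => x; rewrite !inE /c;
    case: (x == v).
have cT : #|[set x | c x == Some true]| = degree G v.
  apply: eq_card => x; rewrite !inE /c; case: (eqVneq x v) => [->|_].
    by rewrite adj_irr.
  by case: (G v x).
move=> k; rewrite card_star_colour; case: k => [[]|] //.
have : (#|V| = #|[set x | c x == Some true]| + #|[set x | c x == Some false]| +
    #|[set x | c x == None]|)%N.
  rewrite -!sum1dep_card -sum1_card [X in (X + _ + _)%N]big_mkcond.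
  rewrite [X in (_ + X + _)%N]big_mkcond [X in (_ + _ + X)%N]big_mkcond
    -!big_split /=.
  by apply: eq_bigr => x _; case: (c x) => [[]|].
rewrite cN cT => E; move/eqP: cV.
by rewrite E eqn_add2r eqn_add2l eq_sym => /eqP.
Qed.

End StarGraphs.

(** * Lower bounds when all vertices but one have small degree *)

Section Classification.

Variables (R : rcfType) (V : finType) (G : sgraph V).
Local Notation mu2 := ('mu[R]_2(G)).
Local Notation deg := (degree G).
Local Notation n := #|V|.
Let t : R := (\sum_u deg u)%:R / n%:R.

Lemma max_vertex (A : {set V}) : A != set0 ->
  exists2 v, v \in A & forall w, w \in A -> (deg w <= deg v)%N.
Proof.
case/set0Pn => v0 v0A; case: (arg_maxnP deg v0A) => v vA vmax.
by exists v.
Qed.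

Lemma avg_lt_bound (a : R) :
  (0 < n)%N -> (t < a) = ((\sum_u deg u)%:R < a * n%:R).
Proof. by move=> n0; rewrite /t ltr_pdivrMr ?ltr0n. Qed.

Lemma bform0_const (y : V -> R) : bform G 0 y (fun=> 1) = 0.
Proof.
rewrite /bform big1 // => u _; have -> : lap G (fun=> 1 : R) u = 0.
  by apply: big1 => w _; rewrite subrr.
by ring.
Qed.

(** Constants lie in the kernel of the Laplacian and are orthogonal to [pair a b], on which the form
    is nonnegative. *)
Lemma mu2_ge0 : (1 < n)%N -> 0 <= mu2.
Proof.
move=> n1; have [a [b aNb]] : exists a b : V, a != b.
  by have /card_gt1P[a [b [_ _ ab]]] := n1; exists a, b.
apply: (mu2_ge n1 (y1 := fun=> 1) (y2 := pair R a b)).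
- by rewrite bform0_const.
- by rewrite bform_pair_diag // mulr0 subr0 -natrM -!natrD.
- by rewrite bform_sym bform0_const.
- rewrite (eq_bigr (fun u => delta R a u * 1 - delta R b u * 1)); last first.
    by move=> u _; rewrite /pair; ring.
  by rewrite sumrB !sum_delta subrr.
- by rewrite sumr_const expr1n -[_ *+ _]/(_%:R) ltr0n cardT -cardE ltnW.
- by rewrite pair_norm.
Qed.

Lemma edgeless_gisom : (0 < n)%N -> (forall u, deg u = 0%N) -> G ~=g n*K1.
Proof.
move=> n0 deg0.
apply: (@colouring_gisom V 'I_n unit G (n*K1) (fun _ _ => false) (fun=> tt) _
  (fun=> tt)) => //.
- exact: Ordinal n0.
- move=> x y; apply/negP => xy; have /eqP := deg0 x.
  by rewrite cards_eq0 => /eqP/setP/(_ y); rewrite !inE xy.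
by case; rewrite !card_setb card_ord.
Qed.

Lemma deg_le1 x a b : (deg x <= 1)%N -> G x a -> G x b -> a = b.
Proof.
move=> /card_le1P H xa xb; have := H a; rewrite inE => /(_ xa b).
by rewrite inE xb inE => /esym/eqP.
Qed.

(** The degree bound leaves no edge between [v u] and [z z'], so their difference vectors are
    orthogonal for the form. Each has value at least [4 - 2 t], and [t < 2]. *)
Lemma mu2_gt_disjoint_edges v z z' : (2 < n)%N ->
  (forall w, w != v -> (deg w <= 1)%N) -> (0 < deg v)%N ->
  G z z' -> z != v -> z' != v -> t < mu2.
Proof.
move=> n2 le1 /card_gt0P[u]; rewrite inE => vu zz zv z'v.
have n1 : (1 < n)%N by exact: ltnW.
have uv : u != v by rewrite eq_sym (adj_neq vu).
have vz : G v z = false.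
  apply/negP; rewrite adj_sym => zv'; have := deg_le1 (le1 z zv) zv' zz.
  by move/eqP; rewrite eq_sym (negPf z'v).
have vz' : G v z' = false.
  apply/negP; rewrite adj_sym => zv';
    have := deg_le1 (le1 z' z'v) zv' (_ : G z' z).
  by rewrite adj_sym => /(_ zz)/eqP; rewrite eq_sym (negPf zv).
have uN w : w != v -> G u w = false.
  move=> wv; apply/negP => uw; have := deg_le1 (le1 u uv) uw (_ : G u v).
  by rewrite adj_sym => /(_ vu)/eqP; rewrite (negPf wv).
have uz : u == z = false by apply: contraFF vz => /eqP <-.
have uz' : u == z' = false by apply: contraFF vz' => /eqP <-.
have deg1 a b : G a b -> 1 <= (deg a)%:R :> R.
  by move=> ab; rewrite ler1n; apply/card_gt0P; exists b; rewrite inE.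
(* Both [deg v] and the sum of the other degrees are at most [n - 1]. *)
have t2 : t < 2.
  rewrite avg_lt_bound ?ltr_nat -?natrM ?ltr_nat; last exact: ltnW.
  rewrite (bigD1 v) //=.
  have h1 : (deg v <= n - 1)%N.
    rewrite subn1 -ltnS prednK ?(ltnW n1) // -cardsT proper_card // properT.
    by apply/eqP => T; have := in_setT v; rewrite -T inE adj_irr.
  have h2 : (\sum_(w | w != v) deg w <= n - 1)%N.
    apply: (@leq_trans (\sum_(w | w != v) 1)%N); first exact: leq_sum.
    by rewrite sum1_card -[#|_|]/(#|predC1 v|) cardC1 subn1.
  apply: leq_ltn_trans (leq_add h1 h2) _; rewrite mul2n -addnn -addSn.
  have h : (n - 1 < n)%N by rewrite subn1 prednK // ltnW // ltnW.
  by apply: leq_add; [exact: h | exact: ltnW h].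
have := deg1 _ _ vu; have := deg1 u v; rewrite adj_sym => /(_ vu).
have := deg1 _ _ zz; have := deg1 z' z; rewrite adj_sym => /(_ zz).
move=> d1 d2 d3 d4.
have p1 : 0 < bform G t (pair R v u) (pair R v u).
  by rewrite bform_pair_diag ?(adj_neq vu) // vu /=; lra.
have p2 : 0 < bform G t (pair R z z') (pair R z z').
  by rewrite bform_pair_diag ?(adj_neq zz) // zz /=; lra.
apply: (mu2_gt n1 p1 p2); rewrite [X in X ^+ 2](_ : _ = 0).
  by rewrite expr0n mulr_gt0.
rewrite bform_pair !bform_deltas vz vz' !uN // uz uz' ![v == _]eq_sym.
by rewrite (negPf zv) (negPf z'v) /=; ring.
Qed.

(** The difference of two leaves [a], [b] has value [deg a + deg b - 2 >= 0] at [t = 1]. *)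
Lemma mu2_ge1_star v : (1 < n)%N -> (forall x y,
  G x y -> (x == v) || (y == v)) ->
  (1 < deg v)%N -> 1 <= mu2.
Proof.
move=> n1 edges_v /card_gt1P[a [b]]; rewrite !inE => -[va vb ab].
have av : a != v by rewrite eq_sym (adj_neq va).
have bv : b != v by rewrite eq_sym (adj_neq vb).
have nab : G a b = false by apply/negP => /edges_v;
  rewrite (negPf av) (negPf bv).
have deg1 x : G v x -> 1 <= (deg x)%:R :> R.
  by move=> vx; rewrite ler1n; apply/card_gt0P; exists v; rewrite inE adj_sym.
have p0 : pair R a b v = 0.
  by rewrite /pair /delta ![v == _]eq_sym (negPf av) (negPf bv) /=; ring.
apply: (mu2_ge_star n1 p0).
- by rewrite lap_pair p0 va vb /=; ring.
- by rewrite ler1n; apply/card_gt0P; exists a; rewrite inE.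
- by rewrite bform_pair_diag // nab; have := deg1 a va; have := deg1 b vb;
  rewrite /=; lra.
- by rewrite pair_norm.
Qed.

End Classification.

(** The colour classes are the neighbourhood of [v] and its complement; the latter is the
    neighbourhood of any neighbour [u] of [v]. *)
Lemma regular_bipartite_gisom (V : finType) (G : sgraph V) (v : V) (d : nat) :
  (0 < d)%N -> (forall u, degree G u = d) ->
  (forall x y, G x y = (G v x != G v y)) ->
  #|V| = (d + d)%N /\ G ~=g 'K_(d, d).
Proof.
move=> d0 reg GE.
have /card_gt0P[u] : (0 < degree G v)%N by rewrite reg.
rewrite inE => vu.
have cT : #|[set x | G v x == true]| = d.
  by rewrite -(reg v); apply: eq_card => x; rewrite !inE eqb_id.
have cF : #|[set x | G v x == false]| = d.
  by rewrite -(reg u); apply: eq_card => x; rewrite !inE (GE u) vu;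
    case: (G v x).
split.
  rewrite -{1}cT -cF -(cardsC [set x | G v x == true]); congr (_ + _)%N.
  by apply: eq_card => x; rewrite !inE; case: (G v x).
apply: (@colouring_gisom V _ bool G 'K_(d, d) (fun a b => a != b)
          (@is_inl _ _) (@biclique_colour d) (G v)) => //.
  exact: (inl (Ordinal d0)).
by move=> k; rewrite card_is_inl; case: k.
Qed.

(** * The bound and its equality cases *)

Section Equality.

Variables (R : rcfType) (V : finType) (G : sgraph V).
Local Notation mu2 := ('mu[R]_2(G)).
Local Notation deg := (degree G).
Local Notation n := #|V|.
Hypothesis n_gt2 : (2 < n)%N.
Let n_gt1 : (1 < n)%N. Proof. exact: ltnW. Qed.
Let n_gt0 : (0 < n)%N. Proof. exact: ltnW. Qed.
Let t : R := (\sum_u deg u)%:R / n%:R.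

Definition extremal : Prop :=
  G ~=g n*K1 \/ (~~ odd n /\ G ~=g 'K_(n./2, n./2))
     \/ (~~ odd n /\ G ~=g 'K_(1, n./2) :u: (n./2 - 1)*K1).

(** Excluding [r = n - 2] gives [deg v > 1], and excluding the small [r] gives [2 deg v <= n]. Hence
    [t = 2 deg v / n <= 1 <= mu2], and [t = 1] only for [n = 2 deg v]. *)
Lemma star_le_or_extremal v : (0 < deg v)%N ->
  (forall x y, G x y -> (x == v) || (y == v)) ->
  (forall r : nat, (0 <= r <= uphalf n - 2)%N \/ r = (n - 2)%N ->
     ~ (G ~=g 'K_(1, n - r - 1) :u: r*K1)) ->
  t < mu2 \/ (t <= mu2 /\ extremal).
Proof.
move=> dv0 edges_v excl.
have dv : (deg v < n)%N.
  rewrite -cardsT proper_card // properT.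
  by apply/eqP => T; have := in_setT v; rewrite -T inE adj_irr.
pose r := (n - 1 - deg v)%N.
have rE : (deg v + r + 1 = n)%N.
  by rewrite /r -subnDA addnAC [(deg v + 1)%N]addnC subnKC // add1n.
have iso := star_gisom edges_v rE.
have nr : (n - r - 1 = deg v)%N by rewrite -rE; lia.
have exr : ~ ((0 <= r <= uphalf n - 2)%N \/ r = (n - 2)%N).
  by move=> /excl; rewrite nr.
have dv1 : (1 < deg v)%N.
  rewrite ltn_neqAle dv0 andbT; apply/eqP => d1; apply: exr; right.
  by rewrite -rE -d1; lia.
(* This keeps the natural subtraction [uphalf n - 2] from being truncated. *)
have up2 : (2 <= uphalf n)%N by rewrite geq_uphalf_double ltnS.
have d2 : (2 * deg v <= n)%N.
  have h : (uphalf n - 2 < r)%N.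
    by rewrite ltnNge; apply/negP => h; apply: exr; left.
  have := odd_double_half n; have := uphalf_half n; rewrite -mul2n.
  by move: h up2 rE; case: (odd n) => /=; set m := n; lia.
have mu1 := mu2_ge1_star R n_gt1 edges_v dv1.
have tE : t = (2 * deg v)%:R / n%:R by rewrite /t (star_sum_degree edges_v).
case: (ltngtP (2 * deg v)%N n) d2 => // [lt_n|eq_n] _; [left | right].
  by apply: lt_le_trans mu1; rewrite tE ltr_pdivrMr ?ltr0n // mul1r ltr_nat.
split.
  by rewrite tE eq_n mulfV // pnatr_eq0 -lt0n.
have hn : n./2 = deg v by rewrite -eq_n mul2n doubleK.
right; right; split; first by rewrite -eq_n mul2n odd_double.
rewrite hn (_ : (deg v - 1 = r)%N) //.
by move: rE; rewrite -eq_n; lia.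
Qed.

(** The disjunction isolates equality: where strictness is not shown the graph is extremal, so the
    equality case only needs an upper bound for extremal graphs. *)
Lemma mu2_ge_avg_or_extremal :
  (forall r : nat, (0 <= r <= uphalf n - 2)%N \/ r = (n - 2)%N ->
     ~ (G ~=g 'K_(1, n - r - 1) :u: r*K1)) ->
  t < mu2 \/ (t <= mu2 /\ extremal).
Proof.
move=> excl.
have [v _ vmax] : exists2 v, v \in [set: V] & forall w,
  w \in [set: V] -> (deg w <= deg v)%N.
  by apply: max_vertex; rewrite -card_gt0 cardsT.
case: (posnP (deg v)) => [dv0|dv0].
  have deg0 u : deg u = 0%N by apply/eqP; rewrite -leqn0 -dv0 vmax.
  right; split; last by left; apply: edgeless_gisom.
  rewrite /t big1 ?mul0r; first exact: mu2_ge0.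
  by move=> u _; rewrite deg0.
have [u] : exists2 u, u \in [set~ v] & forall w,
  w \in [set~ v] -> (deg w <= deg u)%N.
  apply: max_vertex; have /card_gt0P[w] := dv0; rewrite inE => vw.
  by apply/set0Pn; exists w; rewrite !inE eq_sym (adj_neq vw).
rewrite !inE => uv umax'.
have umax w : w != v -> (deg w <= deg u)%N by move=> wv; apply: umax';
  rewrite !inE.
have duv : (deg u <= deg v)%N by apply: vmax.
case: (leqP (deg u) 1) => [du1|du2].
  have le1 w : w != v -> (deg w <= 1)%N by move=> /umax/leq_trans; apply.
  case: (boolP [exists x, [exists y, [&& G x y, x != v & y != v]]]).
    case/existsP=> x /existsP[y /and3P[xy xv yv]]; left.
    exact: (mu2_gt_disjoint_edges R n_gt2 le1 dv0 xy xv yv).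
  move=> noe; apply: (star_le_or_extremal dv0) => // x y xy.
  apply: contraNT noe; rewrite negb_or => /andP[xv yv].
  by apply/existsP; exists x; apply/existsP; exists y; rewrite xy xv.
have du0 : (0 < deg u)%N by exact: ltnW.
have ge2 := mu2_ge_second R n_gt1 uv du2 duv.
case: (ltnP (\sum_w deg w) (n * deg u)) => [lt_avg|ge_avg].
  left; apply: lt_le_trans ge2.
  by rewrite avg_lt_bound // -natrM ltr_nat mulnC.
move: (duv); rewrite leq_eqVlt => /orP[/eqP duv_eq|lt_uv]; last first.
  by left; apply: (mu2_gt_unique_max R n_gt1 umax du2 lt_uv ge_avg).
(* The average reaches the maximum degree, which forces regularity. *)
have le_all w : (deg w <= deg u)%N.
  by case: (eqVneq w v) => [->|/umax //]; rewrite duv_eq.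
have reg w : deg w = deg u.
  apply/eqP; rewrite eqn_leq le_all /= leqNgt; apply/negP => lt_w.
  move: ge_avg; rewrite leqNgt => /negP; apply.
  rewrite -sum_nat_const (bigD1 w) //= [X in (_ < X)%N](bigD1 w) //=.
  by rewrite -addSn leq_add // leq_sum.
have tE : t = (deg u)%:R.
  rewrite /t (eq_bigr (fun=> deg u)) // sum_nat_const natrM mulrC mulKf //.
  by rewrite pnatr_eq0 -lt0n.
rewrite tE; case: (ltP (deg u)%:R mu2) => [|le_mu]; first by left.
right; split => //.
have nlt : ~ ((deg u)%:R < mu2) by move=> h; move: (lt_le_trans h le_mu);
  rewrite ltxx.
have [nE iso] := regular_bipartite_gisom du0 reg (regular_bipartite n_gt1 du0
  reg v nlt).
right; left; rewrite nE addnn odd_double doubleK; split => //.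
Qed.

(** The form at [t] is nonpositive everywhere for the edgeless graph, on vectors of zero sum over
    one side for the biclique, and on vectors vanishing at the centre for the star. *)
Lemma extremal_mu2_le : extremal -> mu2 <= t.
Proof.
case=> [isoE|[[nev isoE]|[nev isoE]]].
- have [f fb Hf] := isoE.
  have G0 x y : G x y = false by rewrite -Hf.
  have -> : t = 0.
    rewrite /t big1 ?mul0r // => u _; apply/eqP.
    by rewrite cards_eq0; apply/eqP/setP => w; rewrite !inE G0.
  apply: (mu2_upper n_gt1 (c := fun=> 0)) => z _.
  rewrite /bform big1 // => u _; rewrite /lap big_pred0 => [|w]; last exact: G0.
  by ring.
- set p := n./2 in isoE.
  have [c [cG cfib]] := @gisom_colouring V _ bool G 'K_(p, p)
    (fun a b => a != b) (@is_inl _ _) (@biclique_colour p) isoE.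
  have degE u : deg u = p.
    rewrite -[RHS](card_is_inl p (~~ c u)) -cfib; apply: eq_card => w.
    by rewrite !inE cG; case: (c u); case: (c w).
  have tE : t = p%:R.
    rewrite /t (eq_bigr (fun=> p)) // sum_nat_const natrM mulrC mulKf //.
    by rewrite pnatr_eq0 -lt0n.
  rewrite tE; apply: (mu2_upper n_gt1 (c := fun x => (c x)%:R)) => z zc.
  have sumT : \sum_(w | c w) z w = 0.
    rewrite -[RHS]zc big_mkcond /=; apply: eq_bigr => w _.
    by case: (c w); rewrite ?mulr1 ?mulr0.
  have -> : bform G p%:R z z = - \sum_u z u * \sum_(w | G u w) z w.
    by rewrite -sumrN; apply: eq_bigr => u _; rewrite lapE degE; ring.
  (* Vertices outside class [c] have neighbour sum zero; those in [c] share one neighbour sum, which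
     factors out of the zero sum over [c]. *)
  rewrite (bigID c) /= [X in _ + X]big1 => [|u /negPf cu]; last first.
    rewrite (eq_bigl c) ?sumT ?mulr0 // => w.
    by rewrite cG cu; case: (c w).
  rewrite (eq_bigr (fun u => z u * \sum_(w | ~~ c w) z w)) => [|u cu];
    last first.
    by congr (_ * _); apply: eq_bigl => w; rewrite cG cu; case: (c w).
  by rewrite -mulr_suml sumT mul0r addr0 oppr0.
set p := n./2 in isoE.
have [c [cG cfib]] := @gisom_colouring V _ _ G _ star_rel (@star_colour p (p -
  1))
  (@star_union_colour p (p - 1)) isoE.
have nE : n = (2 * p)%N by rewrite -[LHS]odd_double_half (negPf nev) add0n
  mul2n.
have /eqP/cards1P[v /setP vE] : #|[set x | c x == None]| = 1%N.
  by rewrite cfib card_star_colour.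
have cv x : (c x == None) = (x == v) by have := vE x; rewrite !inE.
have cvN : c v = None by apply/eqP; rewrite cv.
have edges_v x y : G x y -> (x == v) || (y == v).
  by rewrite -!cv cG; case: (c x) => [[]|]; case: (c y) => [[]|].
have dv : deg v = p.
  transitivity #|[set x | c x == Some true]|;
    last by rewrite cfib card_star_colour.
  by apply: eq_card => x; rewrite !inE cG cvN; case: (c x) => [[]|].
have tE : t = 1.
  by rewrite /t (star_sum_degree edges_v) dv -nE mulfV // pnatr_eq0 -lt0n.
rewrite tE; apply: (mu2_upper n_gt1 (c := delta R v)) => z.
rewrite (eq_bigr (fun x => delta R v x * z x)) => [|x _]; last exact: mulrC.
rewrite sum_delta => zv; rewrite /bform sumr_le0 // => x _.
case: (eqVneq x v) => [->|xv]; first by rewrite zv mul0r.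
rewrite mul1r lapE.
(* A leaf contributes [z x * (z x - z x) = 0] and an isolated vertex [- z x ^+ 2]. *)
case: (boolP (G v x)) => vx.
  have -> : \sum_(w | G x w) z w = 0.
    apply: big1 => w xw; have := edges_v _ _ xw; rewrite (negPf xv) => /eqP ->.
    exact: zv.
  have -> : deg x = 1%N.
    apply/eqP/cards1P; exists v; apply/setP => w; rewrite !inE.
    apply/idP/eqP => [xw|->]; last by rewrite adj_sym.
    by have := edges_v _ _ xw; rewrite (negPf xv) => /eqP.
  by rewrite mul1r subr0 subrr mulr0.
have Gx w : G x w = false.
  apply/negP => xw; have := edges_v _ _ xw; rewrite (negPf xv) => /eqP wv.
  by move: xw; rewrite wv adj_sym (negPf vx).
have -> : deg x = 0%N.
  by apply/eqP; rewrite cards_eq0; apply/eqP/setP => w; rewrite !inE Gx.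
rewrite big_pred0 // mul0r subrr sub0r mulrN oppr_le0 -expr2.
exact: sqr_ge0.
Qed.

End Equality.

Theorem theorem3p5 (R : rcfType) (V : finType) (G : sgraph V) (n m : nat)
    (order_G : order_of G = n) (edges_G : num_edges G = m) (n_gt2 : (2 < n)%N)
    (not_excluded : forall r : nat,
       (0 <= r <= uphalf n - 2)%N \/ r = (n - 2)%N ->
       ~ (G ~=g 'K_(1, n - r - 1) :u: r*K1)) :
  2 * m%:R / n%:R <= 'mu[R]_2(G) /\
  ('mu[R]_2(G) = 2 * m%:R / n%:R <->
     G ~=g n*K1
     \/ (~~ odd n /\ G ~=g 'K_(n./2, n./2))
     \/ (~~ odd n /\ G ~=g 'K_(1, n./2) :u: (n./2 - 1)*K1)).
Proof.
rewrite /order_of in order_G; subst n; subst m.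
have -> : 2 * (num_edges G)%:R / #|V|%:R =
    (\sum_u degree G u)%:R / #|V|%:R :> R by rewrite sum_degree natrM.
(* In the strict branch both sides of the equivalence fail, extremality being refuted by the upper
   bound; in the other branch both hold. *)
have [lt_mu|[le_mu ext]] := mu2_ge_avg_or_extremal R n_gt2 not_excluded.
  split; first exact: ltW.
  split=> [mu_eq|ext]; first by move: lt_mu; rewrite mu_eq ltxx.
  by have := le_lt_trans (extremal_mu2_le R n_gt2 ext) lt_mu; rewrite ltxx.
split=> //; split=> // _.
by apply/eqP; rewrite eq_le le_mu andbT; apply: extremal_mu2_le.
Qed.
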